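(* Let $\mathcal H$ be a separable infinite-dimensional Hilbert space, $G$ a positive semidefinite densely defined self-adjoint operator on $\mathcal H$ with $\inf\{\|G\varphi\| : \varphi\in\mathcal D(G),\|\varphi\|=1\}=0$, and $E>0$. A) The norm $\|\cdot\|^G_E$ is equivalent to the operator norm $\|\cdot\|$ on $\mathfrak B(\mathcal H)$ if and only if the operator $G$ is bounded. B) The norm $\|\cdot\|^G_E$ generates the strong operator topology on bounded subsets of $\mathfrak B(\mathcal H)$ if and only if $G$ is an unbounded discrete operator.
   Context: $\mathfrak B(\mathcal H)$ is the algebra of bounded operators on $\mathcal H$; bounded subsets are meant with respect to the operator norm, and ''generates the strong operator topology on bounded subsets'' means that on every operator-norm-bounded subset of $\mathfrak B(\mathcal H)$ the topology induced by $\|\cdot\|^G_E$ coincides with the strong operator topology. The operator $E$-norm: $\|A\|^G_E:=\sup\{\|A\varphi\|:\varphi\in\mathcal D(\sqrt G),\ \|\varphi\|=1,\ \|\sqrt G\varphi\|^2\le E\}$ for $A\in\mathfrak B(\mathcal H)$; it is known that this equals $\sup\{\sqrt{\mathrm{Tr}\,A\rho A^*}\}$ over all density operators $\rho$ (positive trace-class, trace $1$) with $\mathrm{Tr}\,G\rho\le E$, where $\mathrm{Tr}\,G\rho:=\sup_n\mathrm{Tr}\,P_nG\rho$ and $P_n$ is the spectral projector of $G$ for $[0,n]$. $G$ is discrete if $G=\sum_{k\ge0}E_k|\tau_k\rangle\langle\tau_k|$ on $\mathcal D(G)=\{\varphi:\sum_kE_k^2|\langle\tau_k|\varphi\rangle|^2<\infty\}$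 for an orthonormal basis $\{\tau_k\}_{k\ge0}$ of $\mathcal H$ and a nondecreasing sequence $E_k\ge0$ tending to $+\infty$. *)

(* Defs.v *)
(* The field of scalars is R[i], the complex numbers over an arbitrary R : realType. *)
From mathcomp Require Export all_boot all_order all_algebra.
From mathcomp Require Export sesquilinear complex.
From mathcomp Require Export all_classical all_reals all_analysis.

Set Implicit Arguments.
Unset Strict Implicit.
Unset Printing Implicit Defensive.

Import Order.TTheory GRing.Theory Num.Theory numFieldNormedType.Exports.

Local Open Scope classical_set_scope.
Local Open Scope ring_scope.
Local Open Scope complex_scope.

(* A Hilbert space is a complete normed module H over R[i] with a positive
   definite Hermitian form dot inducing its norm. MathComp forms are linear in
   the first argument, so the bracket <psi|phi> is dot phi psi. *)
Definition braket (R : realType) (H : completeNormedModType R[i])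
    (dot : {dot H for Num.conj}) (psi phi : H) : R[i] := dot phi psi.

Definition induces_norm (R : realType) (H : completeNormedModType R[i])
    (dot : {dot H for Num.conj}) : Prop :=
  forall x : H, `|x| ^+ 2 = braket dot x x.

(* MathComp norms over R[i] take values in R[i]; this is the same number in R. *)
Definition rnorm (R : realType) (V : normedZmodType R[i]) (x : V) : R :=
  complex.Re `|x|.

Definition separable (T : topologicalType) : Prop :=
  exists2 D : set T, countable D & dense D.

Definition infinite_dimensional (K : fieldType) (V : lmodType K) : Prop :=
  forall (n : nat) (b : 'I_n -> V),
    exists x : V, forall c : 'I_n -> K, x != \sum_(i < n) c i *: b i.

Section operators.
Context (R : realType) (H : completeNormedModType R[i]).
Variable dot : {dot H for Num.conj}.
Local Notation "<| psi , phi |>" := (braket dot psi phi).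

(* A possibly unbounded operator; the values of op_fun outside op_dom are
   irrelevant. *)
Record operator := Operator {
  op_dom : set H ;
  op_fun :> H -> H ;
  op_dom0 : op_dom 0 ;
  op_domP : forall (a : R[i]) (x y : H),
    op_dom x -> op_dom y -> op_dom (a *: x + y) ;
  op_linear : forall (a : R[i]) (x y : H),
    op_dom x -> op_dom y -> op_fun (a *: x + y) = a *: op_fun x + op_fun y }.

Definition zero_operator : operator.
Proof.
refine (@Operator setT (fun=> 0) _ _ _) => // a x y _ _.
by rewrite scaler0 addr0.
Defined.

Definition densely_defined (T : operator) : Prop := dense (op_dom T).

(* (psi, eta) is in the graph of the adjoint of T *)
Definition adjoint_graph (T : operator) (psi eta : H) : Prop :=
  forall phi, op_dom T phi -> <|psi, T phi|> = <|eta, phi|>.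

Definition selfadjoint (T : operator) : Prop :=
  densely_defined T /\
  forall psi eta, adjoint_graph T psi eta <-> op_dom T psi /\ T psi = eta.

(* the order of R[i]: 0 <= z means that z is real and nonnegative *)
Definition positive (T : operator) : Prop :=
  forall phi, op_dom T phi -> 0 <= <|phi, T phi|>.

Definition bounded_operator (T : operator) : Prop :=
  exists M : R, forall phi, op_dom T phi -> rnorm (T phi) <= M * rnorm phi.

Definition is_sqrt (S T : operator) : Prop :=
  [/\ selfadjoint S, positive S,
      op_dom T = [set phi | op_dom S phi /\ op_dom S (S phi)] &
      forall phi, op_dom T phi -> T phi = S (S phi)].

(* The square root of a positive self-adjoint operator T exists and is unique
   (up to irrelevant values outside its domain); the default zero_operator only
   serves to make the function total. *)
Definition sqrt_operator (T : operator) : operator :=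
  match pselect (exists S, is_sqrt S T) with
  | left h => projT1 (cid h)
  | right _ => zero_operator
  end.

Definition orthonormal_basis (tau : nat -> H) : Prop :=
  (forall i j, <|tau i, tau j|> = (i == j)%:R) /\
  (forall phi, series (fun k => <|tau k, phi|> *: tau k) @ \oo --> phi).

Definition discrete_operator (T : operator) : Prop :=
  exists (tau : nat -> H) (e : nat -> R),
    [/\ orthonormal_basis tau,
        (forall k, 0 <= e k),
        (forall k l, (k <= l)%N -> e k <= e l) &
        e @ \oo --> +oo] /\
    op_dom T = [set phi |
      (\sum_(0 <= k <oo) (e k ^+ 2 * rnorm <|tau k, phi|> ^+ 2)%:E < +oo)%E] /\
    (forall phi, op_dom T phi ->
       series (fun k => ((e k)%:C * <|tau k, phi|>) *: tau k) @ \oo --> T phi).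

Definition BH : set (H -> H) :=
  [set A | linear A /\
           exists M : R, forall phi, rnorm (A phi) <= M * rnorm phi].

Definition opnorm (A : H -> H) : R :=
  sup [set rnorm (A phi) | phi in [set phi | rnorm phi = 1]].

Definition Enorm (G : operator) (E : R) (A : H -> H) : R :=
  sup [set rnorm (A phi) | phi in [set phi |
    [/\ op_dom (sqrt_operator G) phi, rnorm phi = 1 &
        rnorm (sqrt_operator G phi) ^+ 2 <= E]]].

Definition equivalent_norms (N1 N2 : (H -> H) -> R) : Prop :=
  exists c C : R, [/\ 0 < c, 0 < C &
    forall A, BH A -> c * N2 A <= N1 A /\ N1 A <= C * N2 A].

Definition norm_bounded (S : set (H -> H)) : Prop :=
  exists M : R, forall A, S A -> opnorm A <= M.

(* the open subsets of BH for the metric topology of the norm N *)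
Definition norm_open (N : (H -> H) -> R) : set_system (H -> H) :=
  [set U | U `<=` BH /\ forall A, U A ->
     exists2 eps : R, 0 < eps &
       forall B, BH B -> N (fun phi => B phi - A phi) < eps -> U B].

(* the open subsets of BH for the topology of pointwise convergence in norm *)
Definition sot_open : set_system (H -> H) :=
  [set BH `&` (W : set (H -> H)) | W in
     [set W : set {ptws H -> H} | open W]].

Definition induced_open (T : Type) (O : set_system T) (S : set T) :
    set_system T := [set U `&` S | U in O].

Definition generates_sot_on_bounded (N : (H -> H) -> R) : Prop :=
  forall S : set (H -> H), S `<=` BH -> norm_bounded S ->
    induced_open (norm_open N) S = induced_open sot_open S.

End operators.

(* Main.v *)
Require Import Defs.
From mathcomp Require Import ring lra.
Import Order.TTheory GRing.Theory Num.Theory numFieldNormedType.Exports.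
Set Implicit Arguments.
Unset Strict Implicit.
Unset Printing Implicit Defensive.
Local Open Scope classical_set_scope.
Local Open Scope ring_scope.

(* Let S be the square root of G; it exists as C B^-1 with B = (1 + G)^(-1/2) and
   C = (1 - B^2)^(1/2), the bounded roots being limits of a fixed-point iteration.
   Since G has unit vectors psi of arbitrarily small energy |S psi|^2, writing
   t x = (psi + t x) - psi bounds |A x| by the E-norm of A uniformly over vectors x
   of bounded norm and energy. If G is bounded these are all the unit vectors;
   conversely the rank-one operators phi |-> <S x|phi> u have norm |S x| and
   E-norm at most sqrt(E) |x|, so equivalence of the norms bounds S and G.

   For the same reason the E-norm topology is finer than the strong one on bounded
   sets. When G is discrete, vectors of energy at most E are uniformly close to the
   span of finitely many eigenvectors, which gives the converse. Conversely, if the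
   topologies agree, testing on rank-one operators shows that a sequence of bounded
   norm and energy converges along every ultrafilter. Hence the energy attains its
   minimum on the unit sphere of the complement of any finite set of eigenvectors,
   the minimizer is again an eigenvector, and the eigenvalues so obtained tend to
   infinity, which makes the eigenvectors a basis. *)

Local Open Scope complex_scope.

(** * Real-valued norms and inner products *)

Section real_norm.
Context (R : realType).

Section normed.
Context (V : normedZmodType R[i]).
Implicit Types x y : V.

(** In the order of [R[i]] a nonnegative element has zero imaginary part, so the norm is recovered
    from its real part. *)
Lemma rnormE x : `|x| = (rnorm x)%:C.
Proof.
by rewrite /rnorm; case: `|x| (normr_ge0 x) => a b; rewrite lecE /= => /andP[/eqP-> _].
Qed.

Lemma rnorm_ge0 x : 0 <= rnorm x.
Proof. by rewrite -lecR -rnormE normr_ge0. Qed.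

Lemma rnorm0 : rnorm (0 : V) = 0.
Proof. by rewrite /rnorm normr0. Qed.

Lemma rnorm_eq0 x : (rnorm x == 0) = (x == 0).
Proof.
apply/eqP/eqP => [x0|->]; last exact: rnorm0.
by apply/eqP; rewrite -normr_eq0 rnormE x0 eqxx.
Qed.

Lemma rnorm_gt0 x : (0 < rnorm x) = (x != 0).
Proof. by rewrite lt_def rnorm_ge0 rnorm_eq0 andbT. Qed.

Lemma rnormN x : rnorm (- x) = rnorm x.
Proof. by rewrite /rnorm normrN. Qed.

Lemma rnormBC x y : rnorm (x - y) = rnorm (y - x).
Proof. by rewrite -opprB rnormN. Qed.

Lemma rnormD x y : rnorm (x + y) <= rnorm x + rnorm y.
Proof. by rewrite -lecR rmorphD /= -!rnormE ler_normD. Qed.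

Lemma rnormB x y : rnorm (x - y) <= rnorm x + rnorm y.
Proof. by rewrite -(rnormN y) rnormD. Qed.

Lemma rnorm_sum (I : Type) (r : seq I) (P : pred I) (F : I -> V) :
  rnorm (\sum_(i <- r | P i) F i) <= \sum_(i <- r | P i) rnorm (F i).
Proof.
elim/big_ind2 : _ => [|x a y b xa yb|//]; first by rewrite rnorm0.
exact: le_trans (rnormD _ _) (lerD xa yb).
Qed.

End normed.

Lemma rnormC (a : R) : rnorm (a%:C : R[i]) = `|a|.
Proof. by rewrite /rnorm normc_def /= expr0n addr0 sqrtr_sqr. Qed.

Lemma Re_le_rnorm (z : R[i]) : `|complex.Re z| <= rnorm z.
Proof.
case: z => a b; rewrite /rnorm normc_def /= -sqrtr_sqr ler_wsqrtr //.
by rewrite lerDl sqr_ge0.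
Qed.

Lemma rnorm_le_ReIm (z : R[i]) : rnorm z <= `|complex.Re z| + `|complex.Im z|.
Proof.
case: z => a b; rewrite /rnorm normc_def /=.
rewrite -[leRHS]ger0_norm ?addr_ge0 // -sqrtr_sqr ler_wsqrtr //.
rewrite sqrrD !real_normK ?num_real // -addrA lerD2l lerDr.
by rewrite mulrn_wge0 ?mulr_ge0.
Qed.

Lemma rnorm_sqr (z : R[i]) : rnorm z ^+ 2 = complex.Re z ^+ 2 + complex.Im z ^+ 2.
Proof.
case: z => a b; rewrite /rnorm normc_def /= sqr_sqrtr //.
by rewrite addr_ge0 ?sqr_ge0.
Qed.

Section normed_module.
Context (V : normedModType R[i]).
Implicit Types x y : V.

Lemma rnormZ (a : R[i]) x : rnorm (a *: x) = rnorm a * rnorm x.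
Proof. by apply: complexI; rewrite rmorphM /= -!rnormE normrZ. Qed.

Lemma rnormZr (a : R) x : rnorm (a%:C *: x) = `|a| * rnorm x.
Proof. by rewrite rnormZ rnormC. Qed.

Lemma cvg_rnormP (T : Type) (F : set_system T) {FF : Filter F} (u : T -> V) l :
  u @ F --> l <-> forall e : R, 0 < e -> \forall t \near F, rnorm (u t - l) < e.
Proof.
split=> [/cvgrPdist_lt ul e e0|ul].
  have : 0 < e%:C :> R[i] by rewrite ltcR.
  by move=> /ul; apply: filterS => t; rewrite rnormBC rnormE ltcR.

apply/cvgrPdist_lt => e e0.
have er : e = (complex.Re e)%:C by rewrite RRe_real // realE ltW.
have : 0 < complex.Re e by rewrite -ltcR -er.
move=> /ul; apply: filterS => t.
by rewrite er distrC rnormE ltcR.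
Qed.

Lemma dense_rnormP (D : set V) : dense D ->
  forall x (e : R), 0 < e -> exists2 y, D y & rnorm (x - y) < e.
Proof.
move=> dD x e e0.
have eC : 0 < e%:C :> R[i] by rewrite ltcR.
have [] := dD (ball x e%:C)%classic°.
- by exists x; exact: nbhsx_ballx.
- exact: open_interior.
move=> y [/interior_subset]; rewrite -ball_normE /= => xy Dy.
by exists y => //; rewrite -ltcR -rnormE.
Qed.

End normed_module.

(** The filter is arbitrary because the criterion is used along [\oo] and, later, along
    ultrafilters. *)
Lemma complete_rnorm (V : completeNormedModType R[i]) (T : Type)
    (F : set_system T) {FF : ProperFilter F} (u : T -> V) :
  (forall e : R, 0 < e -> exists2 A, F A &
     forall s t, A s -> A t -> rnorm (u s - u t) < e) ->
  exists l, forall e : R, 0 < e -> \forall t \near F, rnorm (u t - l) < e.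
Proof.
move=> uC; suff : cvg (u @ F).
  by move=> /cvg_ex[l] /cvg_rnormP ul; exists l.
apply/cauchy_cvgP/cauchy_ballP => e e0.
have er : e = (complex.Re e)%:C by rewrite RRe_real // realE ltW.
have : 0 < complex.Re e by rewrite -ltcR -er.
move=> /uC[A FA uA].
have FuA : F (u @^-1` (u @` A)) by apply: filterS FA => t At; exists t.
exists (u @` A, u @` A); first by split.
move=> [x y] /= [[s As <-] [t At <-]].
by rewrite -ball_normE /= er rnormE ltcR uA.
Qed.

End real_norm.

Section inner_product.
Context (R : realType) (H : completeNormedModType R[i]).
Context (dot : {dot H for Num.conj}) (dotH : induces_norm dot).
Implicit Types (x y z : H) (a b : R).

(** Most estimates use only this real inner product; [dotE] recovers the complex form from it. *)
Definition re_dot x y : R := complex.Re (dot x y).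
Local Notation ip := re_dot.

Lemma dotC x y : dot x y = (dot y x)^*.
Proof. by rewrite hermC expr0 mul1r. Qed.

Lemma dotDl x y z : dot (x + y) z = dot x z + dot y z.
Proof. exact: linearDl. Qed.

Lemma dotZl (c : R[i]) x y : dot (c *: x) y = c * dot x y.
Proof. exact: linearZl_LR. Qed.

Lemma dotZr (c : R[i]) x y : dot x (c *: y) = c^* * dot x y.
Proof. by rewrite dotC dotZl rmorphM -[X in _ * X]dotC. Qed.

Lemma dotNl x y : dot (- x) y = - dot x y.
Proof. exact: linearNl. Qed.

Lemma dotBl x y z : dot (x - y) z = dot x z - dot y z.
Proof. exact: linearBl. Qed.

Lemma dot0l x : dot 0 x = 0.
Proof. exact: linear0l. Qed.

Lemma dot0r x : dot x 0 = 0.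
Proof. exact: linear0r. Qed.

Lemma dot_suml (I : Type) (r : seq I) (P : pred I) (F : I -> H) z :
  dot (\sum_(i <- r | P i) F i) z = \sum_(i <- r | P i) dot (F i) z.
Proof. exact: linear_sumlz. Qed.

Lemma dot_sumr (I : Type) (r : seq I) (P : pred I) (F : I -> H) z :
  dot z (\sum_(i <- r | P i) F i) = \sum_(i <- r | P i) dot z (F i).
Proof. exact: linear_sumr. Qed.

Lemma ipC x y : ip x y = ip y x.
Proof. by rewrite /re_dot dotC; case: (dot y x). Qed.

Lemma ReD (u v : R[i]) : complex.Re (u + v) = complex.Re u + complex.Re v.
Proof. by case: u v => ? ? []. Qed.

Lemma ReN (u : R[i]) : complex.Re (- u) = - complex.Re u.
Proof. by case: u. Qed.

Lemma ipDl x y z : ip (x + y) z = ip x z + ip y z.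
Proof. by rewrite /re_dot dotDl ReD. Qed.

Lemma ipNl x y : ip (- x) y = - ip x y.
Proof. by rewrite /re_dot dotNl ReN. Qed.

Lemma ipBl x y z : ip (x - y) z = ip x z - ip y z.
Proof. by rewrite ipDl ipNl. Qed.

Lemma ipZl a x y : ip (a%:C *: x) y = a * ip x y.
Proof. by rewrite /re_dot dotZl; case: (dot x y) => u v /=; rewrite mul0r subr0. Qed.

Lemma ipDr x y z : ip z (x + y) = ip z x + ip z y.
Proof. by rewrite ipC ipDl !(ipC z). Qed.

Lemma ipNr x y : ip x (- y) = - ip x y.
Proof. by rewrite ipC ipNl (ipC y). Qed.

Lemma ipBr x y z : ip z (x - y) = ip z x - ip z y.
Proof. by rewrite ipDr ipNr. Qed.

Lemma ipZr a x y : ip x (a%:C *: y) = a * ip x y.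
Proof. by rewrite ipC ipZl (ipC y). Qed.

Lemma ip0l x : ip 0 x = 0.
Proof. by rewrite /re_dot dot0l. Qed.

Lemma ip0r x : ip x 0 = 0.
Proof. by rewrite ipC ip0l. Qed.

Lemma ipil x y : ip ('i *: x) y = - complex.Im (dot x y).
Proof. by rewrite /re_dot dotZl mulrC ReiNIm. Qed.

Lemma ipir x y : ip x ('i *: y) = - ip ('i *: x) y.
Proof.
rewrite ipC !ipil opprK (dotC y); case: (dot x y) => a b /=.
by rewrite opprK.
Qed.

Lemma dotE x y : dot x y = ip x y -i* ip ('i *: x) y.
Proof. by rewrite ipil opprK /re_dot; case: (dot x y). Qed.

Lemma dotxx x : dot x x = (rnorm x ^+ 2)%:C.
Proof. by have := dotH x; rewrite /braket => <-; rewrite rnormE rmorphXn. Qed.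

Lemma ipxx x : ip x x = rnorm x ^+ 2.
Proof. by rewrite /re_dot dotxx. Qed.

Lemma rnorm_sqrD x y :
  rnorm (x + y) ^+ 2 = rnorm x ^+ 2 + 2 * ip x y + rnorm y ^+ 2.
Proof. by rewrite -!ipxx !ipDl !ipDr (ipC y x); ring. Qed.

Lemma rnorm_sqrB x y :
  rnorm (x - y) ^+ 2 = rnorm x ^+ 2 - 2 * ip x y + rnorm y ^+ 2.
Proof. by rewrite rnorm_sqrD ipNr rnormN; ring. Qed.

Lemma parallelogram x y :
  rnorm (x + y) ^+ 2 + rnorm (x - y) ^+ 2 = 2 * rnorm x ^+ 2 + 2 * rnorm y ^+ 2.
Proof. by rewrite rnorm_sqrD rnorm_sqrB; ring. Qed.

Lemma dot_le x y : rnorm (dot x y) <= rnorm x * rnorm y.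
Proof.
have [->|y0] := eqVneq y 0; first by rewrite dot0r !rnorm0 mulr0.
set c := dot x y; set n := rnorm y.
have n0 : 0 < n by rewrite rnorm_gt0.
have key : 0 <= rnorm x ^+ 2 * n ^+ 2 - rnorm c ^+ 2.
  (* Up to the factor [n ^+ 2], which avoids a division, this is the component of [x] orthogonal to
     [y]. *)
  have := sqr_ge0 (rnorm ((n ^+ 2)%:C *: x - c *: y)).
  rewrite rnorm_sqrB rnormZr rnormZ -/n [`|_|]ger0_norm ?sqr_ge0 // ipZl.
  rewrite [ip _ _](_ : _ = rnorm c ^+ 2); last first.
    rewrite /re_dot dotZr -/c rnorm_sqr; case: c => p q /=; ring.
  rewrite (_ : _ + _ = n ^+ 2 * (rnorm x ^+ 2 * n ^+ 2 - rnorm c ^+ 2)).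
    by rewrite pmulr_rge0 // exprn_gt0.
  ring.
rewrite -(@ler_pXn2r _ 2) ?nnegrE ?mulr_ge0 ?rnorm_ge0 //.
by rewrite exprMn -subr_ge0.
Qed.

Lemma ip_le x y : `|ip x y| <= rnorm x * rnorm y.
Proof. exact: le_trans (Re_le_rnorm _) (dot_le _ _). Qed.

Lemma ip_ler x y : ip x y <= rnorm x * rnorm y.
Proof. exact: le_trans (ler_norm _) (ip_le _ _). Qed.

Lemma dot_le_ip x y : rnorm (dot x y) <= `|ip x y| + `|ip ('i *: x) y|.
Proof. by rewrite ipil normrN; exact: rnorm_le_ReIm. Qed.

Lemma ip_eq0 x : (forall y, ip x y = 0) -> x = 0.
Proof.
by move=> /(_ x); rewrite ipxx => /eqP; rewrite sqrf_eq0 rnorm_eq0 => /eqP.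
Qed.

End inner_product.

(** At [t = - b / d], where [d] exceeds the absolute value of [c], the quadratic term cannot
    compensate a nonzero linear one. This turns minimality into orthogonality in
    [closed_subspace_full] and into an eigenvalue equation in [next_eigenvector_exists]. *)
Lemma linear_term_eq0 (R : realFieldType) (b c : R) :
  (forall t, 0 <= 2 * t * b + t ^+ 2 * c) -> b = 0.
Proof.
move=> bc; apply/eqP; rewrite -sqrf_eq0; apply/eqP/le_anti.
rewrite sqr_ge0 andbT leNgt; apply/negP => b0.
set d := `|c| + 1; have d0 : 0 < d by rewrite ltr_wpDl.
have := bc (- b / d).
rewrite (_ : _ + _ = b ^+ 2 / d * (c / d - 2)); last by field; rewrite gt_eqF.
rewrite pmulr_rge0 ?divr_gt0 // subr_ge0 ler_pdivlMr // /d.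
by have := ler_norm c; have := normr_ge0 c; lra.
Qed.

Lemma nondecreasing_bounded_cvg (R : realType) (u : nat -> R) (M : R) :
  (forall n, u n <= u n.+1) -> (forall n, u n <= M) ->
  exists2 l, u @ \oo --> l & forall n, u n <= l.
Proof.
move=> ui uM; have und : nondecreasing_seq u.
  by apply/nondecreasing_seqP.
have cu : cvgn u.
  by apply: nondecreasing_is_cvgn => //; exists M => _ [n _ <-].
by exists (limn u) => // n; exact: nondecreasing_cvgn_le.
Qed.

Lemma cvg_uniq (K : numFieldType) (V : pseudoMetricNormedZmodType K) (T : Type)
    (F : set_system T) {FF : ProperFilter F} (u : T -> V) (l l' : V) :
  u @ F --> l -> u @ F --> l' -> l = l'.
Proof. exact: (cvg_unique (@norm_hausdorff _ _)). Qed.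

Section limits.
Context (R : realType) (H : completeNormedModType R[i]).
Context (dot : {dot H for Num.conj}) (dotH : induces_norm dot).
Local Notation ip := (re_dot dot).
Implicit Types (x y z : H).

Lemma cvg_ipl (T : Type) (F : set_system T) {FF : Filter F} (u : T -> H) l y :
  u @ F --> l -> ip (u t) y @[t --> F] --> ip l y.
Proof.
move=> /cvg_rnormP ul; apply/cvgrPdist_lt => e e0.
have y0 : 0 < rnorm y + 1 by rewrite ltr_wpDl ?rnorm_ge0.
have := ul _ (divr_gt0 e0 y0); apply: filterS => t.
rewrite ltr_pdivlMr // => ute.
rewrite -ipBl; apply: le_lt_trans (ip_le dotH _ _) _.
rewrite rnormBC; apply: le_lt_trans ute.
by rewrite ler_wpM2l ?rnorm_ge0 // lerDl.
Qed.

Lemma cvg_rnorm (T : Type) (F : set_system T) {FF : Filter F} (u : T -> H) l :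
  u @ F --> l -> rnorm (u t) @[t --> F] --> rnorm l.
Proof.
move=> /cvg_rnormP ul; apply/cvgrPdist_lt => e /ul.
apply: filterS => t; apply: le_lt_trans; rewrite ler_norml.
have := rnormD (u t - l) l; have := rnormD (l - u t) (u t).
rewrite !subrK (rnormBC l) => h1 h2.
by apply/andP; split; lra.
Qed.

Lemma invS_lt (e : R) : 0 < e -> \forall n \near \oo, n.+1%:R^-1 < e.
Proof. by move=> e0; exact: (near_infty_natSinv_lt (PosNum e0)). Qed.

Lemma invS_cvg (u : nat -> H) l :
  (forall n, rnorm (u n - l) < n.+1%:R^-1) -> u @ \oo --> l.
Proof.
move=> ul; apply/cvg_rnormP => e /invS_lt; apply: filterS => n.
exact: lt_trans.
Qed.

End limits.

(** * Orthogonal complements and self-adjoint operators *)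

Section projection.
Context (R : realType) (H : completeNormedModType R[i]).
Context (dot : {dot H for Num.conj}) (dotH : induces_norm dot).
Local Notation ip := (re_dot dot).

(* The distance from z to V is attained, by the parallelogram identity, at a
   point v of V, and z - v is orthogonal to V. *)
Lemma closed_subspace_full (V : set H) :
  V 0 -> (forall a x y, V x -> V y -> V (a *: x + y)) ->
  (forall x, (forall e, 0 < e -> exists2 v, V v & rnorm (x - v) < e) -> V x) ->
  (forall x, (forall v, V v -> ip x v = 0) -> x = 0) -> forall z, V z.
Proof.
move=> V0 VP Vcl Vperp z.
set A := [set rnorm (z - v) ^+ 2 | v in V].
have A0 : A !=set0 by exists (rnorm (z - 0) ^+ 2), 0.
have Alb : lbound A 0 by move=> _ [v _ <-]; exact: sqr_ge0.
have Ainf : has_inf A by split=> //; exists 0.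
set D := inf A.
have DA v : V v -> D <= rnorm (z - v) ^+ 2.
  by move=> Vv; apply: ge_inf; [exists 0|exists v].
have /choice[v vP] : forall n, exists v, V v /\ rnorm (z - v) ^+ 2 < D + n.+1%:R^-1.
  move=> n; have n0 : 0 < n.+1%:R^-1 :> R by rewrite invr_gt0 ltr0n.
  by have [_ [v Vv <-] vD] := inf_adherent n0 Ainf; exists v.
have Vmid x y : V x -> V y -> V ((2^-1)%:C *: (x + y)).
  move=> Vx Vy; rewrite -[_ *: _]addr0; apply: (VP) => //.
  by rewrite -[x]scale1r; exact: VP.
(* The midpoint of [v n] and [v m] lies in [V], so its squared distance to [z] is at least [D],
   while those of [v n] and [v m] barely exceed [D]. *)
have vC n m : rnorm (v n - v m) ^+ 2 < 2 * n.+1%:R^-1 + 2 * m.+1%:R^-1.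
  have [Vn vn] := vP n; have [Vm vm] := vP m.
  have := parallelogram dotH (z - v n) (z - v m).
  have -> : z - v n - (z - v m) = - (v n - v m).
    by rewrite [RHS]opprB opprB addrC addrA subrK.
  have -> : z - v n + (z - v m) = (2:R)%:C *: (z - (2^-1)%:C *: (v n + v m)).
    rewrite scalerBr scalerA -rmorphM /= divff ?pnatr_eq0 // scale1r.
    by rewrite rmorph_nat scaler_nat mulr2n opprD addrACA.
  rewrite rnormN rnormZr exprMn ger0_norm //.
  have := DA _ (Vmid _ _ Vn Vm).
  by move: vn vm; set p := n.+1%:R^-1; set q := m.+1%:R^-1; lra.
have [l vl] : exists l : H, v @ \oo --> l.
  have [|l vl] := @complete_rnorm R H nat \oo _ v; last first.
    by exists l; apply/cvg_rnormP.
  move=> e e0; have e4 : 0 < e ^+ 2 / 4 by rewrite divr_gt0 ?exprn_gt0.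
  exists [set n : nat | n.+1%:R^-1 < e ^+ 2 / 4]; first exact: invS_lt.
  move=> n m /= ne me; rewrite -(@ltr_pXn2r _ 2) ?nnegrE ?rnorm_ge0 ?ltW //.
  apply: lt_trans (vC n m) _.
  by move: ne me; set p := n.+1%:R^-1; set q := m.+1%:R^-1; lra.
have Vl : V l.
  apply: Vcl => e e0; have [n _ nP] := (cvg_rnormP _ _).1 vl e e0.
  by exists (v n); [have [] := vP n|rewrite rnormBC; exact: (nP n (leqnn n))].
have zl : rnorm (z - l) ^+ 2 <= D.
  apply: (@closed_cvg _ _ \oo _ (fun n => rnorm (z - v n) ^+ 2 - n.+1%:R^-1)
     [set x | x <= D]).
  - exact: closed_le.
  - by apply: nearW => n /=; rewrite lerBlDr ltW //; have [] := vP n.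
  - rewrite -[X in _ --> X]subr0; apply: cvgB; last first.
      exact: cvg_harmonic.
    by apply: cvgM; apply: cvg_rnorm; apply: cvgB => //; exact: cvg_cst.
rewrite (_ : z = l) //; apply/eqP; rewrite -subr_eq0; apply/eqP/Vperp => w Vw.
apply/eqP; rewrite -oppr_eq0; apply/eqP.
apply: (@linear_term_eq0 _ _ (rnorm w ^+ 2)) => t.
have : V (t%:C *: w + l) by exact: VP.
move=> /DA; rewrite [_ *: _ + l]addrC opprD addrA (rnorm_sqrB dotH) rnormZr ipZr.
by rewrite exprMn real_normK ?num_real //; move: zl; lra.
Qed.

End projection.

Section operator_theory.
Context (R : realType) (H : completeNormedModType R[i]).
Context (dot : {dot H for Num.conj}) (dotH : induces_norm dot).
Local Notation ip := (re_dot dot).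
Implicit Types (T : operator H) (x y z : H).

Lemma op_domZ T (a : R[i]) x : op_dom T x -> op_dom T (a *: x).
Proof. by move=> Tx; rewrite -[_ *: _]addr0; apply/op_domP/op_dom0. Qed.

Lemma op_domD T x y : op_dom T x -> op_dom T y -> op_dom T (x + y).
Proof. by move=> Tx Ty; rewrite -[x]scale1r; exact: op_domP. Qed.

Lemma op_domN T x : op_dom T x -> op_dom T (- x).
Proof. by rewrite -scaleN1r; exact: op_domZ. Qed.

Lemma op_domB T x y : op_dom T x -> op_dom T y -> op_dom T (x - y).
Proof. by move=> Tx Ty; apply: op_domD => //; exact: op_domN. Qed.

Lemma op_dom_sum T (I : Type) (r : seq I) (P : pred I) (F : I -> H) :
  (forall i, op_dom T (F i)) -> op_dom T (\sum_(i <- r | P i) F i).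
Proof.
by move=> TF; apply: big_ind => // [|x y]; [exact: op_dom0|exact: op_domD].
Qed.

Lemma opD T x y : op_dom T x -> op_dom T y -> T (x + y) = T x + T y.
Proof. by move=> Tx Ty; rewrite -[x]scale1r op_linear // !scale1r. Qed.

Lemma op0 T : T 0 = 0.
Proof.
by apply: (@addrI _ (T 0)); rewrite -opD ?addr0 //; exact: op_dom0.
Qed.

Lemma opZ T (a : R[i]) x : op_dom T x -> T (a *: x) = a *: T x.
Proof.
move=> Tx; rewrite -[a *: x]addr0 op_linear ?op0 ?addr0 //; exact: op_dom0.
Qed.

Lemma opN T x : op_dom T x -> T (- x) = - T x.
Proof. by move=> Tx; rewrite -scaleN1r opZ // scaleN1r. Qed.

Lemma opB T x y : op_dom T x -> op_dom T y -> T (x - y) = T x - T y.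
Proof. by move=> Tx Ty; rewrite opD ?opN //; exact: op_domN. Qed.

Lemma op_sum T (I : Type) (r : seq I) (P : pred I) (F : I -> H) :
  (forall i, op_dom T (F i)) ->
  T (\sum_(i <- r | P i) F i) = \sum_(i <- r | P i) T (F i).
Proof.
move=> TF; elim: r => [|i r ih]; first by rewrite !big_nil op0.
by rewrite !big_cons; case: ifP => // _; rewrite opD ?ih //; exact: op_dom_sum.
Qed.

Lemma ip_ge0 T x : positive dot T -> op_dom T x -> 0 <= ip (T x) x.
Proof. by move=> Tge0 /Tge0; rewrite /braket lecE => /andP[]. Qed.

Section selfadjoint.
Context (T : operator H) (saT : selfadjoint dot T).

Lemma dot_sym x y : op_dom T x -> op_dom T y -> dot (T x) y = dot x (T y).
Proof.
have [_ adjT] := saT => Tx Ty.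
by have /(_ x Tx) := (adjT y (T y)).2 (conj Ty erefl).
Qed.

Lemma ip_sym x y : op_dom T x -> op_dom T y -> ip (T x) y = ip x (T y).
Proof. by move=> Tx Ty; rewrite /re_dot dot_sym. Qed.

(** Real parts suffice to test membership in the adjoint graph, since the domain is stable under
    multiplication by ['i]. *)
Lemma adjoint_ip y z :
  (forall x, op_dom T x -> ip y (T x) = ip z x) -> op_dom T y /\ T y = z.
Proof.
have [_ adjT] := saT => yz; apply/adjT => x Tx; rewrite /braket.
rewrite !(dotE dot) ![ip _ y]ipC ![ip _ z]ipC yz //; congr (_ -i* _).
by rewrite -opZ // yz //; exact: op_domZ.
Qed.

(** The graph of [T] is that of its adjoint, which is closed: each condition [ip y (T w) = ip z w]
    is continuous in [y] and [z]. *)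
Lemma selfadjoint_closed y z :
  (forall e : R, 0 < e -> exists x,
     [/\ op_dom T x, rnorm (x - y) < e & rnorm (T x - z) < e]) ->
  op_dom T y /\ T y = z.
Proof.
move=> yz; apply: adjoint_ip => w Tw.
apply/eqP; rewrite -subr_eq0 -normr_le0; apply/ler_addgt0Pr => e e0.
set c := rnorm (T w) + rnorm w + 1.
have c0 : 0 < c by rewrite ltr_wpDl ?addr_ge0 ?rnorm_ge0.
have [x [Tx xy xz]] := yz _ (divr_gt0 e0 c0).
have -> : ip y (T w) - ip z w = ip (y - x) (T w) + ip (T x - z) w.
  by rewrite !ipBl ip_sym //; ring.
rewrite add0r; apply: le_trans (ler_normD _ _) _.
have -> : e = e / c * rnorm (T w) + e / c * rnorm w + e / c.
  by rewrite -[X in _ + X]mulr1 -!mulrDr -/c divfK ?gt_eqF.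
rewrite -[leLHS]addr0; apply: lerD; last by rewrite ltW // divr_gt0.
apply: lerD; apply: le_trans (ip_le dotH _ _) _.
  by rewrite ler_wpM2r ?rnorm_ge0 // rnormBC ltW.
by rewrite ler_wpM2r ?rnorm_ge0 // ltW.
Qed.

(** Positivity makes the cross term of the expanded square nonnegative. The bound controls both [x]
    and [T x] by [x + T x]. *)
Lemma rnorm_shift x : positive dot T -> op_dom T x ->
  rnorm x ^+ 2 + rnorm (T x) ^+ 2 <= rnorm (x + T x) ^+ 2.
Proof.
move=> Tge0 Tx; rewrite (rnorm_sqrD dotH) ipC -addrA lerD2l lerDr.
by rewrite mulr_ge0 // ip_ge0.
Qed.

(** The range of [1 + T] is a subspace, closed by [rnorm_shift] and [selfadjoint_closed]. A vector
    orthogonal to it satisfies [T x = - x], hence vanishes by positivity. *)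
Lemma shift_surjective : positive dot T ->
  forall z, exists2 x, op_dom T x & x + T x = z.
Proof.
move=> Tge0; apply: (closed_subspace_full dotH).
- by exists 0; [exact: op_dom0|rewrite op0 addr0].
- move=> a _ _ [x Tx <-] [y Ty <-]; exists (a *: x + y); first exact: op_domP.
  by rewrite op_linear // scalerDr addrACA.
- move=> z zcl.
  have /choice[x xP] : forall n, exists x,
      op_dom T x /\ rnorm ((x + T x) - z) < n.+1%:R^-1.
    move=> n; have n0 : 0 < n.+1%:R^-1 :> R by rewrite invr_gt0 ltr0n.
    by have [_ [x Tx <-] xz] := zcl _ n0; exists x; rewrite rnormBC.
  have xzc : (fun n => x n + T (x n)) @ \oo --> z.
    by apply: invS_cvg => n; have [] := xP n.
  have [l xl] : exists l, forall e, 0 < e ->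
      \forall n \near \oo, rnorm (x n - l) < e.
    apply: complete_rnorm => e e0.
    have e2 : 0 < e / 2 by rewrite divr_gt0.
    exists [set n : nat | rnorm ((x n + T (x n)) - z) < e / 2].
      by move/cvg_rnormP: xzc; apply.
    move=> n m /= ne me; have [Tn _] := xP n; have [Tm _] := xP m.
    apply: (@le_lt_trans _ _ (rnorm (x n - x m + T (x n - x m)))).
      rewrite -(@ler_pXn2r _ 2) ?nnegrE ?rnorm_ge0 //.
      apply: le_trans (rnorm_shift Tge0 (op_domB Tn Tm)).
      by rewrite lerDl sqr_ge0.
    rewrite opB // addrACA -opprD -(subrKA z).
    apply: le_lt_trans (rnormD _ _) _.
    by rewrite [X in _ + X]rnormBC; lra.
  have [] : op_dom T l /\ T l = z - l; last by move=> Tl Tlz; exists l => //; rewrite Tlz subrKC.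
  apply: selfadjoint_closed => e e0.
  have e2 : 0 < e / 2 by rewrite divr_gt0.
  have [n [/= nl nz]] := filter_ex (filterI (xl _ e2) ((cvg_rnormP _ _).1 xzc _ e2)).
  have [Tn _] := xP n; exists (x n); split => //; first by lra.
  rewrite (_ : T (x n) - (z - l) = (x n + T (x n) - z) - (x n - l)).
    by apply: le_lt_trans (rnormB _ _) _; lra.
  by rewrite !opprB [RHS]addrC [RHS]addrA subrKA -addrA addrCA.
- move=> x xperp.
  have [Tx Txx] : op_dom T x /\ T x = - x.
    apply: adjoint_ip => w Tw; rewrite ipNl; apply/eqP.
    by rewrite -addr_eq0 -ipDr addrC xperp //; exists w.
  apply/eqP; rewrite -rnorm_eq0 -sqrf_eq0; apply/eqP/le_anti.
  rewrite sqr_ge0 andbT -oppr_ge0 -(ipxx dotH) -ipNl -Txx; exact: ip_ge0.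
Qed.

End selfadjoint.
End operator_theory.

(** * Square roots of positive operators *)

Section linear_maps.
Context (K : pzRingType) (U V : lmodType K) (f : U -> V) (lf : linear f).

Lemma linD x y : f (x + y) = f x + f y.
Proof. by have := lf 1 x y; rewrite !scale1r. Qed.

Lemma lin0 : f 0 = 0.
Proof. by apply: (@addrI _ (f 0)); rewrite -linD !addr0. Qed.

Lemma linZ a x : f (a *: x) = a *: f x.
Proof. by rewrite -[a *: x]addr0 lf lin0 addr0. Qed.

Lemma linN x : f (- x) = - f x.
Proof. by rewrite -scaleN1r linZ scaleN1r. Qed.

Lemma linB x y : f (x - y) = f x - f y.
Proof. by rewrite linD linN. Qed.

Lemma lin_sum (I : Type) (r : seq I) (P : pred I) (F : I -> U) :
  f (\sum_(i <- r | P i) F i) = \sum_(i <- r | P i) f (F i).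
Proof.
elim: r => [|i r ih]; first by rewrite !big_nil lin0.
by rewrite !big_cons; case: ifP => // _; rewrite linD ih.
Qed.

End linear_maps.

Section bounded_sqrt.
Context (R : realType) (H : completeNormedModType R[i]).
Context (dot : {dot H for Num.conj}) (dotH : induces_norm dot).
Local Notation ip := (re_dot dot).
Implicit Types (x y z : H).

Definition half x : H := (2^-1 : R)%:C *: x.

Lemma halfD x : half x + half x = x.
Proof. by rewrite -scalerDl -rmorphD /= -[RHS]scale1r; congr (_%:C *: _); field. Qed.

Lemma rnorm_half x : rnorm (half x) = rnorm x / 2.
Proof. by rewrite rnormZr ger0_norm ?invr_ge0 // mulrC. Qed.

Lemma cvg_lipschitz (f : H -> H) (M : R) (T : Type) (F : set_system T)
    {FF : Filter F} (u : T -> H) l :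
  linear f -> (forall x, rnorm (f x) <= M * rnorm x) ->
  u @ F --> l -> f (u t) @[t --> F] --> f l.
Proof.
move=> lf fM /cvg_rnormP ul; apply/cvg_rnormP => e e0.
have M0 : 0 < `|M| + 1 by rewrite ltr_wpDl.
have := ul _ (divr_gt0 e0 M0); apply: filterS => t; rewrite ltr_pdivlMr // => ue.
rewrite -linB //; apply: le_lt_trans (fM _) (le_lt_trans _ ue).
by rewrite mulrC ler_wpM2l ?rnorm_ge0 // ler_wpDr // ler_norm.
Qed.

Section iteration.
Context (X : H -> H) (linX : linear X)
  (symX : forall x y, ip (X x) y = ip x (X y))
  (X1 : forall x, rnorm (X x) <= rnorm x).

(* Picard iteration for 1 - sqrt (1 - X), the fixed point of
   W |-> (X + W^2) / 2; the scalar iteration with X = 1 bounds its increments. *)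
Fixpoint W_ (n : nat) x : H :=
  if n is m.+1 then half (X x + W_ m (W_ m x)) else 0.

Fixpoint w_ (n : nat) : R := if n is m.+1 then (1 + w_ m ^+ 2) / 2 else 0.

Lemma W_S n x : W_ n.+1 x = half (X x + W_ n (W_ n x)).
Proof. by []. Qed.

Lemma w_S n : w_ n.+1 = (1 + w_ n ^+ 2) / 2.
Proof. by []. Qed.

Lemma w_ge0 n : 0 <= w_ n.
Proof. by case: n => //= n; rewrite divr_ge0 // addr_ge0 // sqr_ge0. Qed.

Lemma w_le1 n : w_ n <= 1.
Proof.
elim: n => //= n ih; rewrite ler_pdivrMr // mul1r.
have : w_ n ^+ 2 <= 1 by rewrite expr_le1 ?w_ge0.
lra.
Qed.

Lemma w_le n : w_ n <= w_ n.+1.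
Proof.
elim: n => [|n ih]; first exact: w_ge0.
rewrite (w_S n.+1) {1}w_S ler_pM2r ?invr_gt0 // lerD2l.
by rewrite ler_pXn2r ?nnegrE ?w_ge0.
Qed.

Lemma W_linear n : linear (W_ n).
Proof.
elim: n => [|n ih] a x y /=; first by rewrite scaler0 addr0.
rewrite linX !ih addrACA -scalerDr /half [LHS]scalerDr !scalerA.
by rewrite (mulrC a).
Qed.

Lemma W_le n x : rnorm (W_ n x) <= w_ n * rnorm x.
Proof.
elim: n x => [|n ih] x /=; first by rewrite rnorm0 mul0r.
rewrite rnorm_half mulrAC ler_pM2r ?invr_gt0 //.
apply: le_trans (rnormD _ _) _; rewrite mulrDl mul1r lerD //.
apply: le_trans (ih _) _; rewrite expr2 -mulrA.
by rewrite ler_wpM2l ?w_ge0.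
Qed.

Lemma W_le1 n x : rnorm (W_ n x) <= rnorm x.
Proof.
apply: le_trans (W_le n x) _; rewrite -[leRHS]mul1r.
by rewrite ler_wpM2r ?rnorm_ge0 ?w_le1.
Qed.

(** The factorization [P^2 - Q^2 = P (P - Q) + (P - Q) Q] for consecutive iterates expresses the
    next increment through the current one; the scalar increments obey the same recursion with
    equality. *)
Lemma W_step n x : rnorm (W_ n.+1 x - W_ n x) <= (w_ n.+1 - w_ n) * rnorm x.
Proof.
elim: n x => [|n ih] x; first by rewrite subr0 subr0; exact: W_le.
have -> : W_ n.+2 x - W_ n.+1 x =
    half (W_ n.+1 (W_ n.+1 x - W_ n x) + (W_ n.+1 (W_ n x) - W_ n (W_ n x))).
  rewrite W_S [X in _ - X]W_S -scalerBr; congr (_ *: _).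
  by rewrite (linB (W_linear n.+1)) addrA subrK opprD addrACA subrr add0r.
have -> : w_ n.+2 - w_ n.+1 =
    (w_ n.+1 * (w_ n.+1 - w_ n) + (w_ n.+1 - w_ n) * w_ n) / 2.
  by rewrite w_S [X in _ - X = _]w_S; field.
rewrite rnorm_half mulrAC ler_pM2r ?invr_gt0 //.
apply: le_trans (rnormD _ _) _.
have := W_le n.+1 (W_ n.+1 x - W_ n x); have := ih (W_ n x).
have := ih x; have := W_le n x; have := w_le n; have := w_ge0 n.+1.
move: (w_ n) (w_ n.+1) (rnorm x) => p q r q0 pq Wr d1 d2 d3.
rewrite mulrDl lerD //.
  by apply: le_trans d3 _; rewrite -mulrA ler_wpM2l.
by apply: le_trans d2 _; rewrite -mulrA ler_wpM2l // subr_ge0.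
Qed.

Lemma W_diff n k x : rnorm (W_ (n + k) x - W_ n x) <= (w_ (n + k) - w_ n) * rnorm x.
Proof.
elim: k => [|k ih]; first by rewrite addn0 !subrr rnorm0 mul0r.
rewrite addnS -(subrKA (W_ (n + k) x)) -(subrKA (w_ (n + k))) mulrDl.
by apply: le_trans (rnormD _ _) _; rewrite lerD // W_step.
Qed.

Lemma W_sym n x y : ip (W_ n x) y = ip x (W_ n y).
Proof.
elim: n x y => [|n ih] x y /=; first by rewrite ip0l ip0r.
by rewrite ipZl ipZr ipDl ipDr symX !ih.
Qed.

Lemma W_comm (A : H -> H) n x :
  linear A -> (forall x, A (X x) = X (A x)) -> A (W_ n x) = W_ n (A x).
Proof.
move=> lA AX; elim: n x => [|n ih] x /=; first exact: lin0.
by rewrite /half (linZ lA) (linD lA) AX !ih.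
Qed.

Lemma W_cvg x : exists l : H, W_ n x @[n --> \oo] --> l.
Proof.
have [l wl wle] := nondecreasing_bounded_cvg w_le w_le1.
have [|y yl] := @complete_rnorm R H nat \oo _ (fun n => W_ n x); last first.
  by exists y; apply/cvg_rnormP.
move=> e e0; have x0 : 0 < rnorm x + 1 by rewrite ltr_wpDl ?rnorm_ge0.
have ex : 0 < e / (rnorm x + 1) by rewrite divr_gt0.
exists [set n | `|l - w_ n| < e / (rnorm x + 1)].
  by move/cvgrPdist_lt : wl; apply.
have key n m : (n <= m)%N -> `|l - w_ n| < e / (rnorm x + 1) ->
    rnorm (W_ n x - W_ m x) < e.
  move=> /subnKC <- nl; rewrite rnormBC; apply: le_lt_trans (W_diff _ _ _) _.
  move: nl; rewrite ltr_pdivlMr //; apply: le_lt_trans.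
  apply: ler_pM; rewrite ?rnorm_ge0 ?lerDl //.
    rewrite subr_ge0; elim: (m - n)%N => [|k ih]; first by rewrite addn0.
    by rewrite addnS; apply: le_trans ih (w_le _).
  by apply: le_trans (ler_norm _); rewrite lerB.
move=> n m /= nl ml; have [nm|/ltnW mn] := leqP n m; first exact: key.
by rewrite rnormBC; exact: key.
Qed.

End iteration.

(** The limit [W] of the iteration for [X = 1 - T] satisfies [2 W = X + W^2], so [B = 1 - W] has
    square [1 - X = T]. The commutation clause passes from the iterates to the limit; it makes the
    roots built in [sqrt_exists] commute. *)
Lemma bounded_sqrt (T : H -> H) : linear T ->
  (forall x y, ip (T x) y = ip x (T y)) ->
  (forall x, rnorm (x - T x) <= rnorm x) ->
  exists B : H -> H,
    [/\ linear B, forall x y, ip (B x) y = ip x (B y),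
        forall x, 0 <= ip (B x) x, forall x, B (B x) = T x &
        (forall x, rnorm (x - B x) <= rnorm x) /\
        forall (A : H -> H) (M : R), linear A ->
          (forall x, rnorm (A x) <= M * rnorm x) ->
          (forall x, A (T x) = T (A x)) -> forall x, A (B x) = B (A x)].
Proof.
move=> lT sT T1; set X := fun x => x - T x.
have lX : linear X.
  by move=> a x y; rewrite /X lT scalerBr opprD addrACA.
have sX x y : ip (X x) y = ip x (X y) by rewrite /X ipBl ipBr sT.
have /choice[W WP] := W_cvg lX T1.
have lW : linear W.
  move=> a x y; apply: (cvg_uniq (WP (a *: x + y))).
  rewrite (_ : (fun n => _) = fun n => a *: W_ X n x + W_ X n y); last first.
    by apply/funext => n; exact: W_linear.
  by apply: cvgD (WP y); apply: cvgZ => //; exact: cvg_cst.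
have sW x y : ip (W x) y = ip x (W y).
  apply: (cvg_uniq (cvg_ipl dotH (WP x))).
  rewrite (_ : (fun n => _) = fun n => ip (W_ X n y) x); last first.
    by apply/funext => n; rewrite (W_sym sX) ipC.
  by rewrite ipC; exact: (cvg_ipl dotH).
have W1 x : rnorm (W x) <= rnorm x.
  apply: (@closed_cvg _ _ \oo _ (fun n => rnorm (W_ X n x)) [set t | t <= rnorm x]).
  - exact: closed_le.
  - by apply: nearW => n; exact: W_le1.
  - exact: cvg_rnorm.
have WW x : W_ X n (W_ X n x) @[n --> \oo] --> W (W x).
  have /cvg_rnormP c1 := WP x; have /cvg_rnormP c2 := WP (W x).
  apply/cvg_rnormP => e e0; have e2 : 0 < e / 2 by rewrite divr_gt0.
  apply: filterS2 (c1 _ e2) (c2 _ e2) => n h1 h2.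
  rewrite -(subrKA (W_ X n (W x))) -(linB (W_linear lX n)).
  apply: le_lt_trans (rnormD _ _) _.
  by have := W_le1 T1 n (W_ X n x - W x); lra.
have cvgS x : W_ X n.+1 x @[n --> \oo] --> W x.
  by have := WP x; rewrite -(cvg_shiftS (fun n => W_ X n x)).
have Wfix x : W x = half (X x + W (W x)).
  apply: (cvg_uniq (cvgS x)).
  apply: cvgZ; [exact: cvg_cst|]; apply: cvgD; [exact: cvg_cst|exact: WW].
have lB : linear (fun x => x - W x).
  by move=> a x y; rewrite lW scalerBr opprD addrACA.
exists (fun x => x - W x); split=> //.
- by move=> x y; rewrite ipBl ipBr sW.
- move=> x; rewrite ipBl (ipxx dotH) subr_ge0.
  apply: le_trans (ip_ler dotH _ _) _; rewrite expr2.
  by rewrite ler_wpM2r ?rnorm_ge0.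
- move=> x; have e : X x + W (W x) = W x + W x by rewrite -(halfD (X x + W (W x))) -Wfix.
  have -> : W (x - W x) = X x - W x.
    rewrite (linB lW) -[W (W x)](addKr (X x)) e opprD opprK.
    by rewrite addrCA opprD [W x + _]addrA subrr sub0r.
  by rewrite opprB addrA subrK /X subKr.
- split=> [x|A M lA AM AT x].
    by rewrite subKr.
  have AX y : A (X y) = X (A y) by rewrite /X (linB lA) AT.
  rewrite (linB lA); congr (_ - _).
  apply: (cvg_uniq (cvg_lipschitz lA AM (WP x))).
  rewrite (_ : (fun n => _) = fun n => W_ X n (A x)); first exact: WP.
  by apply/funext => n; rewrite (W_comm _ _ lA AX).
Qed.

End bounded_sqrt.

(** * The square root of an unbounded positive self-adjoint operator *)

Section unbounded_sqrt.
Context (R : realType) (H : completeNormedModType R[i]).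
Context (dot : {dot H for Num.conj}) (dotH : induces_norm dot).
Local Notation ip := (re_dot dot).
Implicit Types (x y z : H).

(* With B = (1 + G)^(-1/2) and C = (1 - B^2)^(1/2), the operator B x |-> C x on
   the range of B is the square root of G. *)
Section quotient.
Context (B C : H -> H) (lB : linear B) (lC : linear C)
  (B_inj : forall x, B x = 0 -> x = 0).

(** The default 0 is taken outside the range of [B], which is the domain of [quotient_operator]. *)
Definition preimage_of y : H :=
  match pselect (exists x, B x = y) with
  | left h => projT1 (cid h)
  | right _ => 0
  end.

Lemma preimage_ofK x : preimage_of (B x) = x.
Proof.
rewrite /preimage_of; case: pselect => [h|[]]; last by exists x.
case: cid => y /= yx; apply/eqP; rewrite -subr_eq0; apply/eqP/B_inj.
by rewrite (linB lB) yx subrr.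
Qed.

Definition quotient_operator : operator H.
Proof.
refine (@Operator R H (range B) (C \o preimage_of) _ _ _).
- by exists 0 => //; exact: lin0.
- by move=> a _ _ [x _ <-] [y _ <-]; exists (a *: x + y) => //; rewrite lB.
- by move=> a _ _ [x _ <-] [y _ <-] /=; rewrite -lB !preimage_ofK lC.
Defined.

Lemma quotient_operatorE x : quotient_operator (B x) = C x.
Proof. by rewrite /= preimage_ofK. Qed.

End quotient.

Section symmetric.
Context (A : H -> H) (lA : linear A) (sA : forall x y, ip (A x) y = ip x (A y)).

Lemma dot_symP x y : dot (A x) y = dot x (A y).
Proof. by rewrite !(dotE dot) -(linZ lA) !sA. Qed.

Lemma dot_selfE x : dot (A x) x = (ip (A x) x)%:C.
Proof.
rewrite dotE; congr (_ +i* _); have : ip ('i *: A x) x = - ip ('i *: A x) x.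
  by rewrite -[LHS]opprK; congr (- _); rewrite -ipir sA (linZ lA) ipC.
by lra.
Qed.

End symmetric.

Context (G : operator H) (posG : positive dot G) (saG : selfadjoint dot G).

Lemma sqrt_exists : exists S, is_sqrt dot S G.
Proof.
(* [r] is the resolvent [(1 + G)^-1]. Both [r] and [1 - r] turn out to be symmetric contractions, so
   [bounded_sqrt] applies to each: [B] is the root of [r] and [C] that of [1 - r = G r]. *)
have /choice[r rP] : forall z, exists x, op_dom G x /\ x + G x = z.
  by move=> z; have [x Gx <-] := shift_surjective dotH saG posG z; exists x.
have Gr z : G (r z) = z - r z.
  by have [_ e] := rP z; apply/eqP; rewrite eq_sym subr_eq addrC e.
have rK x : op_dom G x -> r (x + G x) = x.
  move=> Gx; have [Gr1 e] := rP (x + G x).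
  apply/eqP; rewrite -subr_eq0 -rnorm_eq0 -sqrf_eq0; apply/eqP/le_anti.
  rewrite sqr_ge0 andbT.
  have := rnorm_shift dotH posG (op_domB Gr1 Gx).
  rewrite opB // addrACA -opprD e subrr rnorm0 expr0n /=.
  by apply: le_trans; rewrite lerDl sqr_ge0.
have r_bd z : rnorm (r z) ^+ 2 + rnorm (z - r z) ^+ 2 <= rnorm z ^+ 2.
  by have [Gz e] := rP z; rewrite -Gr -[in leRHS]e; exact: rnorm_shift.
have r1 z : rnorm (r z) <= rnorm z.
  rewrite -(@ler_pXn2r _ 2) ?nnegrE ?rnorm_ge0 //.
  by apply: le_trans (r_bd z); rewrite lerDl sqr_ge0.
have r2 z : rnorm (z - r z) <= rnorm z.
  rewrite -(@ler_pXn2r _ 2) ?nnegrE ?rnorm_ge0 //.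
  by apply: le_trans (r_bd z); rewrite lerDr sqr_ge0.
have lr : linear r.
  move=> a x y; have [Gx ex] := rP x; have [Gy ey] := rP y.
  rewrite -[in LHS]ex -[in LHS]ey scalerDr addrACA -op_linear // rK //.
  exact: op_domP.
have sr x y : ip (r x) y = ip x (r y).
  have [Gx ex] := rP x; have [Gy ey] := rP y.
  by rewrite -[in LHS]ey -[in RHS]ex ipDl ipDr (ip_sym saG).
have [B [lB sB posB BB [B1 Bcomm]]] := bounded_sqrt dotH lr sr r2.
have lr' : linear (fun x => x - r x).
  by move=> a x y; rewrite lr scalerBr opprD addrACA.
have sr' x y : ip (x - r x) y = ip x (y - r y) by rewrite ipBl ipBr sr.
have r1' x : rnorm (x - (x - r x)) <= rnorm x by rewrite subKr.
have [C [lC sC posC CC [C1 Ccomm]]] := bounded_sqrt dotH lr' sr' r1'.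
(* A second root, with [b^2 = B], serves the positivity of [S]: the pairing of [B x] with [C x]
   equals that of [b x] with [C (b x)], where [C] is positive. *)
have [b [lb sb posb bb [b1 bcomm]]] := bounded_sqrt dotH lB sB B1.
have C_bd x : rnorm (C x) <= 2 * rnorm x.
  rewrite -[C x](subKr x); apply: le_trans (rnormB _ _) _.
  by have := C1 x; lra.
have rC x : r (C x) = C (r x).
  by apply: (Ccomm r 1) => // z; rewrite ?mul1r // (linB lr).
have CB x : C (B x) = B (C x) by apply: (Bcomm C 2) => // z; rewrite rC.
have Cb x : C (b x) = b (C x) by apply: (bcomm C 2) => // z; rewrite CB.
have B_inj x : B x = 0 -> x = 0.
  move=> Bx0; have [_ <-] := rP x; rewrite Gr -BB Bx0 (lin0 lB) subr0.
  by rewrite add0r; have := Gr x; rewrite -BB Bx0 (lin0 lB) subr0 op0.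
have split_id x : x = B (B x) + C (C x) by rewrite BB CC subrKC.
pose S := quotient_operator lB lC B_inj.
have SE x : S (B x) = C x by exact: quotient_operatorE.
have domB x : op_dom S (B x) by exists x.
have domSG x : op_dom G x -> op_dom S x.
  by move=> Gx; rewrite -(rK x Gx) -BB.
have saS : selfadjoint dot S.
  split=> [|psi eta].
    by move=> O O0 oO; have [x [Ox /domSG]] := saG.1 O O0 oO; exists x.
  split=> [adj|[[x _ <-] <-] _ [y _ <-]]; last first.
    by rewrite /braket !SE (dot_symP lC sC) CB -(dot_symP lB sB).
  (* Testing the adjoint relation on the range of [B] gives this identity; then [B^2 + C^2 = 1]
     yields both [psi = B (B psi + C eta)] and [S psi = eta]. *)
  have CBe : C psi = B eta.
    apply/eqP; rewrite -subr_eq0; apply/eqP/(ip_eq0 dotH) => x.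
    rewrite ipC ipBr /re_dot -(dot_symP lC sC) -(dot_symP lB sB).
    by have := adj (B x) (domB x); rewrite /braket SE => ->; rewrite subrr.
  have -> : psi = B (B psi + C eta).
    by rewrite (linD lB) -CB -CBe -split_id.
  by rewrite SE (linD lC) CB CBe -split_id.
exists S; split => //.
- move=> _ [x _ <-]; rewrite SE /braket -(bb x) -(dot_symP lb sb) -Cb.
  by rewrite (dot_selfE lC sC) ler0c.
- apply/seteqP; split=> [x Gx|_ [[x _ <-]]].
    split; first exact: domSG.
    by rewrite -(rK x Gx) -BB SE CB; exact: domB.
  (* If [C x = B y], then [x = B (B x) + C (C x) = B (B x + C y)], so [B x] is [r (B x + C y)] and
     lies in the domain of [G]. *)
  rewrite SE => -[y _ BC].
  rewrite (split_id x) -BC CB -(linD lB) BB.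
  by have [] := rP (B x + C y).
- by move=> x Gx; rewrite -(rK x Gx) -BB SE CB SE CC BB Gr.
Qed.

End unbounded_sqrt.

(** A set that is empty or unbounded above is covered too: its [sup] is 0 by convention. *)
Lemma sup_ge0 (R : realType) (A : set R) : (forall x, A x -> 0 <= x) -> 0 <= sup A.
Proof.
move=> A0; have [supA|/sup_out->//] := pselect (has_sup A).
by have [x Ax] := supA.1; apply: le_trans (A0 _ Ax) (ub_le_sup supA.2 Ax).
Qed.

(** * The operator norm and the E-norm *)

Section operator_norms.
Context (R : realType) (H : completeNormedModType R[i]).
Context (dot : {dot H for Num.conj}) (dotH : induces_norm dot).
Local Notation ip := (re_dot dot).
Implicit Types (A B : H -> H) (x y z : H).

Lemma BH_bound A : BH A -> exists2 M : R, 0 <= M & forall x, rnorm (A x) <= M * rnorm x.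
Proof.
move=> [_ [M AM]]; exists `|M| => // x; apply: le_trans (AM x) _.
by rewrite ler_wpM2r ?rnorm_ge0 // ler_norm.
Qed.

Lemma BHB A B : BH A -> BH B -> BH (fun x => B x - A x).
Proof.
move=> hA hB; split.
  by move=> a x y; rewrite hA.1 hB.1 scalerBr opprD addrACA.
have [M _ AM] := BH_bound hA; have [N _ BN] := BH_bound hB.
exists (N + M) => x; apply: le_trans (rnormB _ _) _.
by rewrite mulrDl lerD.
Qed.

(** This is the operator [|x><y|]; such operators are the test operators in the necessity halves of
    both equivalences. *)
Definition rank_one x y : H -> H := fun z => dot z y *: x.

Lemma rnorm_rank_one x y z : rnorm (rank_one x y z) <= rnorm x * rnorm y * rnorm z.
Proof.
rewrite rnormZ mulrC -mulrA ler_wpM2l ?rnorm_ge0 // mulrC.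
exact: dot_le.
Qed.

Lemma rank_oneP x y : BH (rank_one x y).
Proof.
split; last by exists (rnorm x * rnorm y); exact: rnorm_rank_one.
by move=> a u v; rewrite /rank_one dotDl dotZl scalerDl scalerA.
Qed.

Lemma normalized x : x != 0 -> rnorm ((rnorm x)^-1%:C *: x) = 1.
Proof.
move=> x0.
by rewrite rnormZr gtr0_norm ?invr_gt0 ?rnorm_gt0 // mulVf // rnorm_eq0.
Qed.

Lemma exists_unit : infinite_dimensional H -> exists x : H, rnorm x = 1.
Proof.
move=> /(_ 0%N (fun=> 0)) [x /(_ (fun=> 0))]; rewrite big_ord0 => x0.
by exists ((rnorm x)^-1%:C *: x); exact: normalized.
Qed.

Lemma rnorm_le_unit A c : linear A ->
  (forall x, rnorm x = 1 -> rnorm (A x) <= c) -> forall x, rnorm (A x) <= c * rnorm x.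
Proof.
move=> lA Ac x; have [->|x0] := eqVneq x 0.
  by rewrite (lin0 lA) !rnorm0 mulr0.
have := Ac _ (normalized x0); rewrite (linZ lA) rnormZr.
by rewrite gtr0_norm ?invr_gt0 ?rnorm_gt0 // mulrC ler_pdivrMr ?rnorm_gt0.
Qed.

Lemma opnorm_ub A x : BH A -> rnorm (A x) <= opnorm A * rnorm x.
Proof.
move=> hA; apply: (rnorm_le_unit hA.1) => {}x x1.
apply: ub_le_sup; last by exists x.
have [M _ AM] := BH_bound hA; exists M => _ [y /= y1 <-].
by rewrite -[M]mulr1 -y1.
Qed.

Lemma opnorm_ge0 A : 0 <= opnorm A.
Proof.
by apply: sup_ge0 => _ [x _ <-]; exact: rnorm_ge0.
Qed.

(** Infinite dimension provides a unit vector, so the supremum is over a nonempty set. *)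
Lemma opnorm_le A c : infinite_dimensional H ->
  (forall x, rnorm x = 1 -> rnorm (A x) <= c) -> opnorm A <= c.
Proof.
move=> /exists_unit[x x1] Ac; apply: ge_sup; first by exists (rnorm (A x)), x.
by move=> _ [y y1 <-]; exact: Ac.
Qed.

End operator_norms.

(** * The E-norm and its comparison with the operator norm *)

Section E_norm.
Context (R : realType) (H : completeNormedModType R[i]).
Context (dot : {dot H for Num.conj}) (dotH : induces_norm dot).
Context (infH : infinite_dimensional H).
Context (G : operator H) (posG : positive dot G) (saG : selfadjoint dot G).
Context (infG : inf [set rnorm (G phi) | phi in
                   [set phi | op_dom G phi /\ rnorm phi = 1]] = 0).
Context (E : R) (E_gt0 : 0 < E).
Local Notation ip := (re_dot dot).
Implicit Types (A B : H -> H) (x y z : H).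

Local Notation S := (sqrt_operator dot G).
Local Notation "`| A |_E" := (Enorm dot G E A).

Lemma sqrt_operatorP : is_sqrt dot S G.
Proof.
rewrite /sqrt_operator; case: pselect => [h|[]]; first by case: cid.
exact: sqrt_exists.
Qed.

Lemma sqrt_sa : selfadjoint dot S. Proof. by case: sqrt_operatorP. Qed.

Lemma domG_sqrt x : op_dom G x <-> op_dom S x /\ op_dom S (S x).
Proof. by case: sqrt_operatorP => _ _ ->. Qed.

Lemma G_sqrt x : op_dom G x -> G x = S (S x).
Proof. by case: sqrt_operatorP => _ _ _; apply. Qed.

Lemma rnorm_sqrt x : op_dom G x -> rnorm (S x) ^+ 2 = ip (G x) x.
Proof.
move=> Gx; have [Sx SSx] := (domG_sqrt x).1 Gx.
by rewrite G_sqrt // -(ipxx dotH) -(ip_sym sqrt_sa).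
Qed.

(** A unit vector with small [G x] has small energy, since the energy is [ip (G x) x]. *)
Lemma ground e : 0 < e ->
  exists x, [/\ op_dom G x, rnorm x = 1 & rnorm (S x) ^+ 2 < e].
Proof.
move=> e0; pose A := [set rnorm (G phi) | phi in
           [set phi | op_dom G phi /\ rnorm phi = 1]].
(* Nonemptiness must be checked, as the infimum of the empty set is also 0; a vector of the dense
   domain close to a unit vector is nonzero and can be normalized. *)
have A0 : A !=set0.
  have [u u1] := exists_unit infH.
  have [y Gy uy] := dense_rnormP saG.1 u (@ltr01 R).
  have y0 : y != 0.
    by apply: contraTneq uy => ->; rewrite subr0 u1 ltxx.
  exists (rnorm (G ((rnorm y)^-1%:C *: y))), ((rnorm y)^-1%:C *: y) => //.
  by split; [exact: op_domZ|exact: normalized].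
have Ainf : has_inf A.
  by split=> //; exists 0 => _ [x _ <-]; exact: rnorm_ge0.
have [_ [x [Gx x1] <-]] := inf_adherent e0 Ainf.
rewrite [inf A]infG add0r => Gxe; exists x; split=> //; rewrite rnorm_sqrt //.
by apply: le_lt_trans (ip_ler dotH _ _) _; rewrite x1 mulr1.
Qed.

Lemma Enorm_unit A x : BH A -> op_dom S x -> rnorm x = 1 ->
  rnorm (S x) ^+ 2 <= E -> rnorm (A x) <= `|A|_E.
Proof.
move=> hA Sx x1 xE; apply: ub_le_sup; last by exists x.
have [M _ AM] := BH_bound hA; exists M => _ [y /= [_ y1 _] <-].
by rewrite -[M]mulr1 -y1.
Qed.

(** By [ground] the set of admissible vectors is nonempty, so an upper bound passes to the
    supremum. *)
Lemma Enorm_le A c :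
  (forall x, op_dom S x -> rnorm x = 1 -> rnorm (S x) ^+ 2 <= E -> rnorm (A x) <= c) ->
  `|A|_E <= c.
Proof.
move=> Ac; have [x [/domG_sqrt[Sx _] x1 xE]] := ground E_gt0.
apply: ge_sup; first by exists (rnorm (A x)), x => //; split=> //; exact: ltW.
by move=> _ [y [Sy y1 yE] <-]; exact: Ac.
Qed.

Lemma Enorm_ge0 A : 0 <= `|A|_E.
Proof. by apply: sup_ge0 => _ [x _ <-]; exact: rnorm_ge0. Qed.

Lemma Enorm_triangle A B D : BH A -> BH B -> BH D ->
  `|fun x => D x - A x|_E <= `|fun x => D x - B x|_E + `|fun x => B x - A x|_E.
Proof.
move=> hA hB hD; apply: Enorm_le => x Sx x1 xE; rewrite -(subrKA (B x)).
apply: le_trans (rnormD _ _) _.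
by rewrite lerD // (Enorm_unit (BHB _ _) Sx x1 xE).
Qed.

(** Normalizing [x] reduces to the energy constraint; the homogeneous form applies directly to sums
    of vectors. *)
Lemma Enorm_ub A x : BH A -> op_dom S x ->
  rnorm (S x) <= Num.sqrt E * rnorm x -> rnorm (A x) <= `|A|_E * rnorm x.
Proof.
move=> hA Sx xE; have [->|x0] := eqVneq x 0.
  by rewrite (lin0 hA.1) !rnorm0 mulr0.
have n0 : 0 < rnorm x by rewrite rnorm_gt0.
have := @Enorm_unit A ((rnorm x)^-1%:C *: x) hA (op_domZ _ Sx) (normalized x0).
rewrite opZ // (linZ hA.1) !rnormZr gtr0_norm ?invr_gt0 // mulrC [_^-1 * _]mulrC.
rewrite !ler_pdivrMr // => -> //; rewrite exprMn exprVn ler_pdivrMr ?exprn_gt0 //.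
rewrite -(sqr_sqrtr (ltW E_gt0)) -exprMn ler_pXn2r ?nnegrE ?rnorm_ge0 //.
by rewrite mulr_ge0 ?rnorm_ge0 ?sqrtr_ge0.
Qed.

(* If psi is a unit vector of small energy, then psi + t x satisfies the energy
   constraint for small t, and t A x = A (psi + t x) - A psi. *)
Lemma Enorm_controls (K : R) : exists2 c, 0 < c & forall A x, BH A -> op_dom S x ->
  rnorm x <= 1 -> rnorm (S x) <= K -> rnorm (A x) <= c * `|A|_E.
Proof.
set s := Num.sqrt E; have s0 : 0 < s by rewrite sqrtr_gt0.
have e0 : 0 < (s / 4) ^+ 2 by rewrite exprn_gt0 // divr_gt0.
have [p [/domG_sqrt[Sp _] p1 pE]] := ground e0.
have {pE} pE : rnorm (S p) <= s / 4.
  by rewrite -(@ler_pXn2r _ 2) ?nnegrE ?rnorm_ge0 ?ltW // divr_gt0.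
set k := `|K| + 1; have k0 : 0 < k by rewrite ltr_wpDl.
(* With this [t], the vector [y = p + t x] has norm between 3/4 and 5/4 and [rnorm (S y) <= s / 2],
   so [Enorm_ub] applies to it. *)
pose t := Num.min (1 / 4) (s / 4 / k).
have t0 : 0 < t by rewrite lt_min !divr_gt0.
have t1 : t <= 1 / 4 by rewrite ge_min lexx.
have tk : t * k <= s / 4.
  by rewrite -ler_pdivlMr // ge_min lexx orbT.
(* The terms [A y] and [A p] contribute at most 5/4 and 1 times the E-norm, rounded up to 3. *)
exists (3 / t); first by rewrite divr_gt0.
move=> A x hA Sx x1 xK.
have tx : rnorm (t%:C *: x) <= 1 / 4.
  by rewrite rnormZr gtr0_norm //; apply: le_trans t1; rewrite ler_piMr // ltW.
have Stx : op_dom S (t%:C *: x) by exact: op_domZ.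
have tS : rnorm (S (t%:C *: x)) <= s / 4.
  rewrite opZ // rnormZr gtr0_norm //; apply: le_trans tk.
  rewrite ler_pM2l //; apply: le_trans xK _.
  by rewrite /k; have := ler_norm K; lra.
set y := p + t%:C *: x.
have y1 : 3 / 4 <= rnorm y.
  by have := rnormB y (t%:C *: x); rewrite addrK p1; lra.
have y2 : rnorm y <= 5 / 4.
  by apply: le_trans (rnormD _ _) _; rewrite p1; lra.
have Sy : op_dom S y by exact: op_domD.
have SyE : rnorm (S y) <= s * rnorm y.
  rewrite opD //; apply: le_trans (rnormD _ _) _.
  have : s * (3 / 4) <= s * rnorm y by rewrite ler_pM2l.
  by lra.
have Ay := Enorm_ub hA Sy SyE.
have Ap : rnorm (A p) <= `|A|_E.
  rewrite -[leRHS]mulr1 -p1; apply: Enorm_ub => //.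
  by rewrite p1 mulr1 -/s; lra.
rewrite mulrAC ler_pdivlMr // mulrC.
have -> : t * rnorm (A x) = rnorm (A y - A p).
  by rewrite (linD hA.1) addrC addKr (linZ hA.1) rnormZr gtr0_norm.
apply: le_trans (rnormB _ _) _.
have : `|A|_E * rnorm y <= `|A|_E * (5 / 4) by rewrite ler_wpM2l ?Enorm_ge0.
by have := Enorm_ge0 A; lra.
Qed.

Lemma Enorm_le_opnorm A : BH A -> `|A|_E <= opnorm A.
Proof.
move=> hA; apply: Enorm_le => x _ x1 _.
by rewrite -[opnorm A]mulr1 -x1 opnorm_ub.
Qed.

(** Approximate any vector from the dense domain: by boundedness the images form a Cauchy sequence,
    and [G] is closed. *)
Lemma bounded_everywhere_defined : bounded_operator G -> forall x, op_dom G x.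
Proof.
move=> [M GM] y.
have /choice[x xP] : forall n, exists x, op_dom G x /\ rnorm (x - y) < n.+1%:R^-1.
  move=> n; have n0 : 0 < n.+1%:R^-1 :> R by rewrite invr_gt0 ltr0n.
  by have [x Gx yx] := dense_rnormP saG.1 y n0; exists x; rewrite rnormBC.
have xy : x @ \oo --> y by apply: invS_cvg => n; have [] := xP n.
have /cvg_rnormP xy' := xy.
set N := `|M| + 1; have N0 : 0 < N by rewrite ltr_wpDl.
have GN u : op_dom G u -> rnorm (G u) <= N * rnorm u.
  move=> Gu; apply: le_trans (GM _ Gu) _; rewrite ler_wpM2r ?rnorm_ge0 //.
  by rewrite ler_wpDr // ler_norm.
have [z Gz] : exists z, forall e, 0 < e -> \forall n \near \oo, rnorm (G (x n) - z) < e.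
  apply: complete_rnorm => e e0.
  have e2 : 0 < e / N / 2 by rewrite !divr_gt0.
  exists [set n | rnorm (x n - y) < e / N / 2]; first exact: xy'.
  move=> n m /= ny my; rewrite -opB; [|by have [] := xP n|by have [] := xP m].
  apply: le_lt_trans (GN _ _) _; first by apply: op_domB; [have [] := xP n|have [] := xP m].
  rewrite mulrC -ltr_pdivlMr // -(subrKA y); apply: le_lt_trans (rnormD _ _) _.
  by rewrite [X in _ + X]rnormBC; lra.
have [] // : op_dom G y /\ G y = z.
apply: (selfadjoint_closed dotH saG) => e e0.
have [n [/= nl nz]] := filter_ex (filterI (xy' _ e0) (Gz _ e0)).
by exists (x n); split => //; have [] := xP n.
Qed.

Lemma equivalent_of_bounded : bounded_operator G ->
  equivalent_norms (Enorm dot G E) (@opnorm R H).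
Proof.
move=> bG; have domG := bounded_everywhere_defined bG; have [M GM] := bG.
(* On unit vectors the squared norm of [S x] is at most the absolute value of [M]; adding 1 gives a
   bound on [rnorm (S x)] without taking a root. *)
have [c c0 cP] := Enorm_controls (`|M| + 1).
exists c^-1, 1; split; rewrite ?invr_gt0 // => A hA.
rewrite mul1r Enorm_le_opnorm //; split=> //.
rewrite mulrC ler_pdivrMr // mulrC; apply: opnorm_le => // x x1.
apply: cP => //; rewrite ?x1 //; first by have [] := (domG_sqrt x).1 (domG x).
have M0 := normr_ge0 M.
rewrite -(@ler_pXn2r _ 2) ?nnegrE ?rnorm_ge0 ?addr_ge0 // rnorm_sqrt //.
apply: le_trans (ip_ler dotH _ _) _; rewrite x1 mulr1.
have := GM x (domG x); rewrite x1 mulr1 => /le_trans; apply.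
apply: le_trans (ler_norm _) _; rewrite sqrrD mulr1 expr1n.
by have := sqr_ge0 `|M|; lra.
Qed.

Lemma bounded_of_equivalent : equivalent_norms (Enorm dot G E) (@opnorm R H) ->
  bounded_operator G.
Proof.
move=> [c [C [c0 _ cP]]]; set s := Num.sqrt E.
have SK x : op_dom S x -> rnorm (S x) <= s / c * rnorm x.
  move=> Sx; have [u u1] := exists_unit infH.
  have [->|Sx0] := eqVneq (S x) 0.
    by rewrite rnorm0 mulr_ge0 ?rnorm_ge0 // divr_ge0 ?sqrtr_ge0 // ltW.
  have hA := rank_oneP dotH u (S x).
  have [le1 _] := cP _ hA.
  (* Evaluation at [S x] itself bounds the operator norm from below; for the E-norm, symmetry moves
     [S] onto the test vector, where the energy constraint applies. *)
  have le2 : rnorm (S x) <= opnorm (rank_one dot u (S x)).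
    have := opnorm_ub (S x) hA; rewrite /rank_one (dotxx dotH) rnormZr u1 mulr1.
    by rewrite ger0_norm ?sqr_ge0 // expr2 ler_pM2r // rnorm_gt0.
  have le3 : `|rank_one dot u (S x)|_E <= s * rnorm x.
    apply: Enorm_le => y Sy y1 yE; rewrite /rank_one rnormZ u1 mulr1.
    rewrite -(dot_sym sqrt_sa) //; apply: le_trans (dot_le dotH _ _) _.
    rewrite ler_wpM2r ?rnorm_ge0 // -(@ler_pXn2r _ 2) ?nnegrE ?rnorm_ge0 ?sqrtr_ge0 //.
    by rewrite sqr_sqrtr // ltW.
  rewrite mulrAC ler_pdivlMr // mulrC; apply: le_trans le3; apply: le_trans le1.
  by rewrite ler_pM2l.
exists (s / c * (s / c)) => x Gx; have [Sx SSx] := (domG_sqrt x).1 Gx.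
rewrite G_sqrt //; apply: le_trans (SK _ SSx) _; rewrite -[leRHS]mulrA.
by rewrite ler_wpM2l ?SK // divr_ge0 ?sqrtr_ge0 // ltW.
Qed.

End E_norm.

(** * Comparison of the topologies on bounded sets *)

Section pointwise_topology.
Context (R : realType) (H : completeNormedModType R[i]).
Implicit Types (f g : H -> H).

(** The sets containing a basic neighbourhood of [f] form a filter that converges pointwise to [f],
    so every neighbourhood of [f] belongs to it. *)
Lemma ptws_open_basis (W : set {ptws H -> H}) f : open W -> W f ->
  exists (s : seq H) (d : R), 0 < d /\
    forall g, (forall x, x \in s -> rnorm (g x - f x) < d) -> W g.
Proof.
move=> oW Wf.
pose F : set_system (H -> H) := [set U | exists (s : seq H) (d : R), 0 < d /\
    forall g, (forall x, x \in s -> rnorm (g x - f x) < d) -> U g].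
have FF : Filter F.
  split.
  - by exists [::], 1.
  - move=> P Q [s [d [d0 sP]]] [t [e [e0 tQ]]].
    exists (s ++ t), (Num.min d e); rewrite lt_min d0 e0; split=> // g gst.
    split; [apply: sP|apply: tQ] => x xs.
      by have := gst x; rewrite mem_cat xs lt_min => /(_ isT) /andP[].
    by have := gst x; rewrite mem_cat xs orbT lt_min => /(_ isT) /andP[].
  - by move=> P Q PQ [s [d [d0 sP]]]; exists s, d; split=> // g /sP /PQ.
have : {ptws, F --> f}.
  apply/pointwise_cvgP => x; apply/cvg_rnormP => e e0.
  by exists [:: x], e; split=> // g; apply; rewrite mem_seq1.
by apply; exact: open_nbhs_nbhs.
Qed.

Lemma ptws_basis_open (s : seq H) f (d : R) :
  open [set g : {ptws H -> H} | forall x, x \in s -> rnorm (g x - f x) < d].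
Proof.
elim: s => [|x s ih].
  by rewrite (_ : [set _ | _] = [set: {ptws H -> H}]); [exact: openT|exact/seteqP].
have -> : [set g : {ptws H -> H} | forall y, y \in x :: s -> rnorm (g y - f y) < d] =
    [set g | rnorm (g x - f x) < d] `&`
    [set g | forall y, y \in s -> rnorm (g y - f y) < d].
  apply/seteqP; split=> [g gs|g [gx gs] y].
    by split=> [|y ys]; apply: gs; rewrite inE ?eqxx ?ys ?orbT.
  by rewrite inE => /predU1P[->|/gs].
apply: openI => //.
  apply: (@open_comp {ptws H -> H} H (fun g => g x) [set z | rnorm (z - f x) < d]).
    by move=> g _; exact: proj_continuous.
  rewrite openE => z /= zd; rewrite /interior.
  have : rnorm (w - f x) @[w --> z] --> rnorm (z - f x).
    by apply: cvg_rnorm; apply: cvgB; [exact: cvg_id|exact: cvg_cst].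
  by move/cvgr_lt; apply.
Qed.

End pointwise_topology.

Section E_norm_topology.
Context (R : realType) (H : completeNormedModType R[i]).
Context (dot : {dot H for Num.conj}) (dotH : induces_norm dot).
Context (infH : infinite_dimensional H).
Context (G : operator H) (posG : positive dot G) (saG : selfadjoint dot G).
Context (infG : inf [set rnorm (G phi) | phi in
                   [set phi | op_dom G phi /\ rnorm phi = 1]] = 0).
Context (E : R) (E_gt0 : 0 < E).
Local Notation ip := (re_dot dot).
Implicit Types (A B D : H -> H) (x y z : H).
Local Notation S := (sqrt_operator dot G).
Local Notation "`| A |_E" := (Enorm dot G E A).

Lemma Enorm_controls_vector y : op_dom S y ->
  exists2 c, 0 < c & forall A, BH A -> rnorm (A y) <= c * `|A|_E.
Proof.
move=> Sy; set n := rnorm y + 1; have n0 : 0 < n by rewrite ltr_wpDl ?rnorm_ge0.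
have [c c0 cP] := Enorm_controls dotH infH posG saG infG E_gt0 (n^-1 * rnorm (S y)).
exists (n * c); first by rewrite mulr_gt0.
move=> A hA; rewrite -mulrA -ler_pdivrMl //.
have -> : n^-1 * rnorm (A y) = rnorm (A (n^-1%:C *: y)).
  by rewrite (linZ hA.1) rnormZr gtr0_norm ?invr_gt0.
apply: cP => //; first exact: op_domZ.
  by rewrite rnormZr gtr0_norm ?invr_gt0 // ler_pdivrMl // mulr1 lerDl.
by rewrite opZ // rnormZr gtr0_norm ?invr_gt0.
Qed.

(** Approximate [x] by [y] in the dense domain of [S]: the norm bound [M] controls [D (x - y)], the
    E-norm controls [D y]. *)
Lemma pointwise_of_Enorm (M : R) x e : 0 < e -> exists2 d : R, 0 < d &
  forall D, BH D -> opnorm D <= M -> `|D|_E < d -> rnorm (D x) < e.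
Proof.
move=> e0; set m := `|M| + 1; have m0 : 0 < m by rewrite ltr_wpDl.
have [Sd _] := sqrt_sa dotH posG saG.
have e2 : 0 < e / 2 by rewrite divr_gt0.
have [y Sy] := dense_rnormP Sd x (divr_gt0 e2 m0); rewrite ltr_pdivlMr // => xy.
have [c c0 cP] := Enorm_controls_vector Sy.
exists (e / 2 / c); first by rewrite divr_gt0.
move=> D hD DM; rewrite ltr_pdivlMr // => DE.
rewrite -(subrK y x) (linD hD.1); apply: le_lt_trans (rnormD _ _) _.
have h1 := cP D hD; have h2 := opnorm_ub (x - y) hD.
have h3 : opnorm D * rnorm (x - y) <= m * rnorm (x - y).
  rewrite ler_wpM2r ?rnorm_ge0 //; apply: le_trans DM _.
  by have := ler_norm M; rewrite /m; lra.
by rewrite mulrC in DE; rewrite mulrC in xy; lra.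
Qed.

Lemma pointwise_of_Enorm_seq (M : R) (s : seq H) e : 0 < e -> exists2 d : R, 0 < d &
  forall D, BH D -> opnorm D <= M -> `|D|_E < d ->
    forall x, x \in s -> rnorm (D x) < e.
Proof.
move=> e0; elim: s => [|x s [d d0 ih]]; first by exists 1.
have [c c0 xP] := pointwise_of_Enorm M x e0.
exists (Num.min c d); first by rewrite lt_min c0.
move=> D hD DM; rewrite lt_min => /andP[Dc Dd] y; rewrite inE => /predU1P[->|].
  exact: xP.
exact: ih.
Qed.

(* On bounded sets the E-norm topology is always finer than the strong one, so
   generates_sot_on_bounded amounts to the converse inclusion. *)
Definition Enorm_small_on_sot : Prop := forall (M e : R), 0 < e ->
  exists (s : seq H) (d : R), 0 < d /\ forall D, BH D -> opnorm D <= M ->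
    (forall x, x \in s -> rnorm (D x) < d) -> `|D|_E < e.

Lemma generates_sot_of_small : Enorm_small_on_sot ->
  generates_sot_on_bounded (Enorm dot G E).
Proof.
move=> small X XBH [M XM].
have XB A B : X A -> X B -> opnorm (fun x => B x - A x) <= M + M.
  move=> XA XB; apply: opnorm_le => // x x1; apply: le_trans (rnormB _ _) _.
  have := opnorm_ub x (XBH _ XA); have := opnorm_ub x (XBH _ XB).
  by have := XM _ XA; have := XM _ XB; rewrite x1; lra.
apply/seteqP; split=> V.
  move=> [U [UBH Uo] <-].
  (* A union of basic strong neighbourhoods centred at points [A] of [U] and [X], chosen so that a
     difference [D = B - A] of norm at most [M + M] and small on the list forces [B] into [U]. *)
  pose W := \bigcup_(p in [set p : (H -> H) * seq H * R | U p.1.1 /\ X p.1.1 /\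
      forall D, BH D -> opnorm D <= M + M ->
        (forall x, x \in p.1.2 -> rnorm (D x) < p.2) ->
        forall B, BH B -> (forall x, B x - p.1.1 x = D x) -> U B])
    [set g : {ptws H -> H} | forall x, x \in p.1.2 -> rnorm (g x - p.1.1 x) < p.2].
  exists (@BH R H `&` (W : set (H -> H))).
    by exists W => //; apply: bigcup_open => -[[A s] d] _; exact: ptws_basis_open.
  apply/seteqP; split=> B.
    move=> [[hB [[[A s] d] /= [UA [XA sd]] Bs]] XB']; split=> //.
    by apply: (sd (fun x => B x - A x)) => //; [apply: BHB => //; exact: XBH|exact: XB].
  move=> [UB XB']; split=> //; split; first exact: UBH.
  have [e e0 eU] := Uo _ UB.
  have [s [d [d0 sd]]] := small (M + M) e e0.
  exists (B, s, d) => /=; last by move=> x _; rewrite subrr rnorm0.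
  split=> //; split=> // D hD DM Ds C hC CD; apply: eU => //.
  by rewrite (_ : (fun phi => _) = D); [exact: sd|apply/funext].
move=> [_ [W Wo <-] <-].
(* Conversely, [U] is a union of E-norm balls centred in [X] and [W] whose points in [X] lie in [W];
   the triangle inequality makes it open. *)
pose U := [set B | BH B /\ exists A (e : R), [/\ X A, W A,
  forall C, X C -> `|fun x => C x - A x|_E < e -> W C &
  `|fun x => B x - A x|_E < e]].
exists U.
  split=> [B []//|B [hB [A [e [XA WA AW Be]]]]].
  exists (e - `|fun x => B x - A x|_E); first by rewrite subr_gt0.
  move=> C hC CB; split=> //; exists A, e; split=> //.
  apply: le_lt_trans (Enorm_triangle dotH infH posG saG infG E_gt0 (XBH _ XA) hB hC) _.
  by move: CB; lra.
apply/seteqP; split=> B.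
  move=> [[hB [A [e [XA WA AW Be]]]] XB']; split=> //; split=> //.
  exact: AW.
move=> [[hB WB] XB']; split=> //; split=> //.
have [s [d [d0 sd]]] := ptws_open_basis Wo WB.
have [e e0 eP] := pointwise_of_Enorm_seq (M + M) s d0.
exists B, e; split=> //.
  move=> C XC Ce; apply: sd => x xs.
  by apply: (eP (fun x => C x - B x)) => //; [apply: BHB => //; exact: XBH|exact: XB].
rewrite (_ : (fun phi => _) = fun=> 0); last by apply/funext => x; rewrite subrr.
apply: le_lt_trans e0; apply: Enorm_le => // x _ _ _.
by rewrite rnorm0.
Qed.

(** Compare neighbourhoods of 0 in the unit ball: the trace of the E-norm ball of radius [e] is that
    of a strongly open set, which contains a basic neighbourhood. *)
Lemma small_of_generates_sot : generates_sot_on_bounded (Enorm dot G E) ->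
  forall (e : R), 0 < e ->
  exists (s : seq H) (d : R), 0 < d /\ forall D, BH D -> opnorm D <= 1 ->
    (forall x, x \in s -> rnorm (D x) < d) -> `|D|_E < e.
Proof.
move=> gen e e0; pose X : set (H -> H) := [set A | BH A /\ opnorm A <= 1].
have Xe := gen X (fun A XA => XA.1).
pose U : set (H -> H) := [set A | BH A /\ `|A|_E < e].
have BH0 : BH (fun=> 0 : H).
  by split; [move=> a x y; rewrite scaler0 addr0|exists 0 => x; rewrite rnorm0 mul0r].
have E0 : `|fun=> 0|_E = 0.
  by apply/le_anti; rewrite Enorm_ge0 andbT; apply: Enorm_le => // x _ _ _; rewrite rnorm0.
have o0 : opnorm (fun=> 0 : H) <= 1.
  by apply: opnorm_le => // x _; rewrite rnorm0.
have Uo : norm_open (Enorm dot G E) U.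
  split=> [A []//|A [hA Ae]]; exists (e - `|A|_E); first by rewrite subr_gt0.
  move=> B hB BA; split=> //.
  have := Enorm_triangle dotH infH posG saG infG E_gt0 BH0 hA hB.
  rewrite (_ : (fun x => B x - 0) = B); last by apply/funext => x; rewrite subr0.
  rewrite (_ : (fun x => A x - 0) = A); last by apply/funext => x; rewrite subr0.
  by move: BA; lra.
have : induced_open (norm_open (Enorm dot G E)) X (U `&` X) by exists U.
rewrite Xe; last by exists 1 => A [].
move=> [_ [W Wo <-] UW].
have [_ W0] : (@BH R H `&` (W : set (H -> H))) (fun=> 0).
  suff : (@BH R H `&` (W : set (H -> H)) `&` X) (fun=> 0) by case.
  by rewrite UW; split; split=> //; rewrite E0.
have [s [d [d0 sd]]] := ptws_open_basis Wo W0; exists s, d; split=> // D hD D1 Ds.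
suff : (U `&` X) D by case=> -[].
rewrite -UW; split=> //; split=> //; apply: sd => x xs.
by rewrite subr0; exact: Ds.
Qed.

End E_norm_topology.

Lemma nneseries_ltyP (R : realType) (u : nat -> R) : (forall n, 0 <= u n) ->
  ((\sum_(0 <= k <oo) (u k)%:E < +oo)%E <->
   exists M : R, forall n, \sum_(0 <= k < n) u k <= M).
Proof.
move=> u0; split=> [|[M uM]].
  have u0' n : (0 <= (u n)%:E)%E by rewrite lee_fin.
  have := nneseries_ge0 (fun n (_ : (0 <= n)%N) (_ : xpredT n) => u0' n).
  case: (\sum_(0 <= k <oo) (u k)%:E)%E (@nneseries_lim_ge R (fun k => (u k)%:E) xpredT 0).
  - move=> r uS _ _; exists r => n; rewrite -lee_fin -sumEFin.
    exact: uS.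
  - by [].
  - by [].
have uM' n : (\sum_(0 <= k < n) (u k)%:E <= M%:E)%E by rewrite sumEFin lee_fin.
apply: (@le_lt_trans _ _ M%:E); last exact: ltry.
apply: lime_le; last by apply: nearW.
by apply: is_cvg_nneseries => n _ _; rewrite lee_fin.
Qed.

(** * Discrete operators *)

Section orthonormal_sequences.
Context (R : realType) (H : completeNormedModType R[i]).
Context (dot : {dot H for Num.conj}) (dotH : induces_norm dot).
Local Notation ip := (re_dot dot).
Context (tau : nat -> H) (tauP : forall i j, dot (tau i) (tau j) = (i == j)%:R).

Definition partial_proj (n : nat) (x : H) : H :=
  \sum_(0 <= k < n) dot x (tau k) *: tau k.

Lemma dot_orthonormal_sum (r : seq nat) (c : nat -> R[i]) j : uniq r ->
  dot (\sum_(k <- r) c k *: tau k) (tau j) = (if j \in r then c j else 0).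
Proof.
move=> ur; rewrite dot_suml.
under eq_bigr do rewrite dotZl tauP.
case: ifPn => jr.
  rewrite (bigD1_seq j) //= eqxx mulr1 big1 ?addr0 // => i /negbTE ->.
  by rewrite mulr0.
rewrite big_seq big1 // => i ir; case: eqP => [ij|_]; last by rewrite mulr0.
by rewrite -ij ir in jr.
Qed.

Lemma ip_orthonormal_sum (r : seq nat) (c d : nat -> R[i]) : uniq r ->
  dot (\sum_(k <- r) c k *: tau k) (\sum_(k <- r) d k *: tau k) =
  \sum_(k <- r) c k * (d k)^*.
Proof.
move=> ur; rewrite dot_sumr; apply: eq_big_seq => j jr.
by rewrite dotZr dot_orthonormal_sum // jr mulrC.
Qed.

Lemma mulC_conj (z : R[i]) : z * z^* = (rnorm z ^+ 2)%:C.
Proof. by rewrite -normCK rnormE rmorphXn. Qed.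

Lemma rnorm_orthonormal_sum (r : seq nat) (c : nat -> R[i]) : uniq r ->
  rnorm (\sum_(k <- r) c k *: tau k) ^+ 2 = \sum_(k <- r) rnorm (c k) ^+ 2.
Proof.
move=> ur; apply: complexI; rewrite -(dotxx dotH) ip_orthonormal_sum //.
by rewrite raddf_sum; apply: eq_bigr => k _; exact: mulC_conj.
Qed.

Lemma rnorm_tau k : rnorm (tau k) = 1.
Proof.
apply/eqP; rewrite -(@eqrXn2 _ 2) ?rnorm_ge0 // expr1n.
by apply/eqP/complexI; rewrite -(dotxx dotH) tauP eqxx.
Qed.

Lemma dot_partial_proj n x k :
  dot (partial_proj n x) (tau k) = (if (k < n)%N then dot x (tau k) else 0).
Proof.
by rewrite dot_orthonormal_sum ?iota_uniq // mem_index_iota.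
Qed.

Lemma partial_proj_perp n x k : (k < n)%N -> dot (x - partial_proj n x) (tau k) = 0.
Proof. by move=> kn; rewrite dotBl dot_partial_proj kn subrr. Qed.

Lemma rnorm_partial_proj n x :
  rnorm (partial_proj n x) ^+ 2 = \sum_(0 <= k < n) rnorm (dot x (tau k)) ^+ 2.
Proof. by rewrite rnorm_orthonormal_sum ?iota_uniq. Qed.

Lemma ip_partial_proj n x :
  ip (partial_proj n x) x = rnorm (partial_proj n x) ^+ 2.
Proof.
rewrite rnorm_partial_proj /re_dot /partial_proj dot_suml raddf_sum.
by apply: eq_bigr => k _; rewrite dotZl (dotC _ (tau k)) mulC_conj.
Qed.

Lemma pythagoras n x :
  rnorm (partial_proj n x) ^+ 2 + rnorm (x - partial_proj n x) ^+ 2 = rnorm x ^+ 2.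
Proof.
rewrite (rnorm_sqrB dotH) ipC ip_partial_proj; ring.
Qed.

Lemma bessel n x :
  \sum_(0 <= k < n) rnorm (dot x (tau k)) ^+ 2 <= rnorm x ^+ 2.
Proof. by rewrite -rnorm_partial_proj -(pythagoras n x) lerDl sqr_ge0. Qed.

Lemma partial_proj_compl_le n x : rnorm (x - partial_proj n x) <= rnorm x.
Proof.
rewrite -(@ler_pXn2r _ 2) ?nnegrE ?rnorm_ge0 // -(pythagoras n x).
by rewrite lerDr sqr_ge0.
Qed.

Lemma partial_proj_diff m n x : (m <= n)%N ->
  partial_proj n x - partial_proj m x = \sum_(m <= k < n) dot x (tau k) *: tau k.
Proof.
move=> mn; apply/eqP; rewrite subr_eq [eqbRHS]addrC; apply/eqP.
exact: (big_cat_nat (leq0n m) mn).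
Qed.

End orthonormal_sequences.

Section discrete_small.
Context (R : realType) (H : completeNormedModType R[i]).
Context (dot : {dot H for Num.conj}) (dotH : induces_norm dot).
Context (infH : infinite_dimensional H).
Context (G : operator H) (posG : positive dot G) (saG : selfadjoint dot G).
Context (infG : inf [set rnorm (G phi) | phi in
                   [set phi | op_dom G phi /\ rnorm phi = 1]] = 0).
Context (E : R) (E_gt0 : 0 < E).
Local Notation ip := (re_dot dot).
Local Notation S := (sqrt_operator dot G).

(** The only nonzero coefficient of [tau k] is the one of index [k], so both series are
    stationary. *)
Lemma discrete_eigenvectors (tau : nat -> H) (e : nat -> R) :
  (forall i j, dot (tau i) (tau j) = (i == j)%:R) ->
  op_dom G = [set phi |
      (\sum_(0 <= k <oo) (e k ^+ 2 * rnorm (dot phi (tau k)) ^+ 2)%:E < +oo)%E] ->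
  (forall phi, op_dom G phi ->
       series (fun k => ((e k)%:C * dot phi (tau k)) *: tau k) @ \oo --> G phi) ->
  forall k, op_dom G (tau k) /\ G (tau k) = (e k)%:C *: tau k.
Proof.
move=> tauP domG GE k.
have Gk : op_dom G (tau k).
  rewrite domG; apply/nneseries_ltyP.
    by move=> n; rewrite mulr_ge0 ?sqr_ge0.
  exists (e k ^+ 2) => n.
  have [kn|nk] := ltnP k n.
    rewrite (bigD1_seq k) ?iota_uniq ?mem_index_iota //= tauP eqxx.
    rewrite big1 => [|i ik]; first by rewrite rnormC normr1 expr1n mulr1 addr0.
    by rewrite tauP eq_sym (negbTE ik) rnorm0 expr0n mulr0.
  rewrite big_nat big1 ?sqr_ge0 // => i /= iN.
  by rewrite tauP gtn_eqF ?(leq_trans iN) // rnorm0 expr0n mulr0.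
split=> //; apply: (cvg_uniq (GE _ Gk)); apply/cvg_rnormP => d d0.
exists k.+1 => // n /= kn.
rewrite [series _ _](_ : _ = (e k)%:C *: tau k) ?subrr ?rnorm0 //.
rewrite /series /= (bigD1_seq k) ?iota_uniq ?mem_index_iota //= tauP eqxx mulr1.
by rewrite big1 ?addr0 // => i ik; rewrite tauP eq_sym (negbTE ik) mulr0 scale0r.
Qed.

(** For the block [q] of the expansion of [x] between [n] and [m], [ip (S q) (S x) = ip (G q) x =
    rnorm (S q) ^+ 2], so [rnorm (S q) <= rnorm (S x)] by Cauchy-Schwarz. The energy of [q] is at
    least [e n * rnorm q ^+ 2]; then [m] tends to infinity. *)
Lemma energy_tail (tau : nat -> H) (e : nat -> R) :
  orthonormal_basis dot tau -> (forall k l, (k <= l)%N -> e k <= e l) ->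
  (forall k, op_dom G (tau k) /\ G (tau k) = (e k)%:C *: tau k) ->
  forall n x, op_dom S x ->
    e n * rnorm (x - partial_proj dot tau n x) ^+ 2 <= rnorm (S x) ^+ 2.
Proof.
move=> [tauO tauC] emono eig n x Sx.
have tauP i j : dot (tau i) (tau j) = (i == j)%:R by rewrite eq_sym; exact: tauO.
have saS := sqrt_sa dotH posG saG.
have key m : (n <= m)%N ->
    e n * rnorm (partial_proj dot tau m x - partial_proj dot tau n x) ^+ 2
      <= rnorm (S x) ^+ 2.
  move=> nm; rewrite partial_proj_diff //; set q := \sum_(_ <= _ < _) _.
  have Gc k : op_dom G (dot x (tau k) *: tau k) by apply: op_domZ; have [] := eig k.
  have Gq : op_dom G q by apply: op_dom_sum.
  have [Sq SSq] := (domG_sqrt dotH posG saG q).1 Gq.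
  have GqE : G q = \sum_(n <= k < m) ((e k)%:C * dot x (tau k)) *: tau k.
    rewrite op_sum //; apply: eq_bigr => k _; have [Gk Ek] := eig k.
    by rewrite opZ // Ek !scalerA mulrC.
  have energy y : (forall k, (n <= k < m)%N -> dot y (tau k) = dot x (tau k)) ->
      ip (G q) y = \sum_(n <= k < m) e k * rnorm (dot x (tau k)) ^+ 2.
    move=> yx; rewrite GqE /re_dot dot_suml raddf_sum; apply: eq_big_nat => k knm.
    rewrite dotZl (dotC _ (tau k)) yx // -mulrA mulC_conj /=.
    by rewrite mulr0 subr0.
  have eq1 : rnorm (S q) ^+ 2 = \sum_(n <= k < m) e k * rnorm (dot x (tau k)) ^+ 2.
    rewrite (rnorm_sqrt dotH posG saG Gq); apply: energy => k knm.
    by rewrite dot_orthonormal_sum ?iota_uniq // mem_index_iota knm.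
  have eq2 : ip (S q) (S x) = rnorm (S q) ^+ 2.
    rewrite eq1 -(energy x) // (G_sqrt dotH posG saG Gq).
    by rewrite -(ip_sym saS).
  have SqSx : rnorm (S q) <= rnorm (S x).
    have := ip_ler dotH (S q) (S x); rewrite eq2 expr2.
    have := rnorm_ge0 (S q); rewrite le_eqVlt => /orP[/eqP <- _|q0].
      exact: rnorm_ge0.
    by rewrite ler_pM2l.
  apply: (@le_trans _ _ (rnorm (S q) ^+ 2)); last first.
    by rewrite ler_pXn2r ?nnegrE ?rnorm_ge0.
  rewrite eq1 /q (rnorm_orthonormal_sum dotH tauP) ?iota_uniq // mulr_sumr.
  rewrite !big_nat; apply: ler_sum => k /andP[nk _].
  by rewrite ler_wpM2r ?sqr_ge0 // emono.
have cvgP : partial_proj dot tau m x - partial_proj dot tau n x @[m --> \oo]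
    --> x - partial_proj dot tau n x.
  by apply: cvgB; [exact: (tauC x)|exact: cvg_cst].
apply: (@closed_cvg _ _ \oo _ (fun m =>
   e n * rnorm (partial_proj dot tau m x - partial_proj dot tau n x) ^+ 2)
   [set t | t <= rnorm (S x) ^+ 2]).
- exact: closed_le.
- by exists n.
- apply: cvgM; [exact: cvg_cst|].
  by apply: cvgM; exact: cvg_rnorm.
Qed.

Lemma small_of_discrete : discrete_operator dot G -> Enorm_small_on_sot dot G E.
Proof.
move=> [tau [e [[tauB e0 emono einfty] [domG GE]]]] M d d0.
have tauP i j : dot (tau i) (tau j) = (i == j)%:R by rewrite eq_sym; exact: tauB.1.
have eig := discrete_eigenvectors tauP domG GE.
set m := `|M| + 1; have m0 : 0 < m by rewrite ltr_wpDl.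
(* A tail of norm at most [a] contributes at most [m * a = d / 4], and [E / a ^+ 2 < e n] makes the
   tail that small. *)
set a := d / 4 / m; have a0 : 0 < a by rewrite !divr_gt0.
have [n en] : exists n, E / a ^+ 2 < e n.
  by have /cvgryPgt/(_ (E / a ^+ 2)) [N _ /(_ N (leqnn N))] := einfty; exists N.
(* The [n] remaining terms together contribute at most [d / 4]; dividing by [n.+1] also covers
   [n = 0]. *)
exists [seq tau k | k <- iota 0 n], (d / 4 / n.+1%:R); split.
  by rewrite !divr_gt0.
move=> D hD DM Ds.
apply: (@le_lt_trans _ _ (d / 2)); last by rewrite ltr_pdivrMr //; lra.
apply: Enorm_le => // x Sx x1 xE.
have tail : rnorm (x - partial_proj dot tau n x) <= a.
  have en0 : 0 < e n by apply: lt_trans en; rewrite divr_gt0 // exprn_gt0.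
  rewrite -(@ler_pXn2r _ 2) ?nnegrE ?rnorm_ge0 ?(ltW a0) // -(ler_pM2l en0).
  apply: le_trans (energy_tail tauB emono eig _ Sx) _; apply: le_trans xE _.
  by rewrite -ler_pdivrMr ?exprn_gt0 // ltW.
have h1 : rnorm (D (x - partial_proj dot tau n x)) <= d / 4.
  apply: le_trans (opnorm_ub _ hD) _.
  apply: (@le_trans _ _ (m * a)); last by rewrite mulrC divfK ?gt_eqF.
  apply: ler_pM; rewrite ?opnorm_ge0 ?rnorm_ge0 //.
  by apply: le_trans DM _; have := ler_norm M; rewrite /m; lra.
have h2 : rnorm (D (partial_proj dot tau n x)) <= d / 4.
  rewrite (lin_sum hD.1); apply: le_trans (rnorm_sum _ _ _) _.
  apply: (@le_trans _ _ (\sum_(0 <= k < n) d / 4 / n.+1%:R)); last first.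
    rewrite sumr_const_nat subn0 -[_ *+ n]mulr_natr -mulrA ler_piMr //.
      by rewrite divr_ge0 // ltW.
    by rewrite mulrC ler_pdivrMr // mul1r ler_nat.
  rewrite !big_nat; apply: ler_sum => k /= kn.
  rewrite (linZ hD.1) rnormZ.
  have xk : rnorm (dot x (tau k)) <= 1.
    by apply: le_trans (dot_le dotH _ _) _; rewrite x1 mul1r (rnorm_tau dotH tauP).
  have Dk : rnorm (D (tau k)) < d / 4 / n.+1%:R.
    by apply: Ds; apply: map_f; rewrite mem_iota.
  apply: le_trans (ltW Dk); rewrite -[leRHS]mul1r.
  by rewrite ler_wpM2r ?rnorm_ge0.
rewrite -(subrK (partial_proj dot tau n x) x) (linD hD.1).
by apply: le_trans (rnormD _ _) _; lra.
Qed.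

End discrete_small.

Lemma ultra_fmap (T U : Type) (F : set_system T) (f : T -> U) :
  UltraFilter F -> UltraFilter (f @ F).
Proof.
move=> FU; split=> [|K PK FK]; first exact: fmap_proper_filter.
apply/seteqP; split=> // A KA; have [//|FA] := in_ultra_setVsetC (f @^-1` A) FU.
have /filter_ex[y []] // : K (A `&` ~` A) by apply: filterI => //; exact: FK.
Qed.

(** The image ultrafilter converges, because a closed bounded interval is compact. *)
Lemma ultra_bounded_close (R : realType) (T : Type) (F : set_system T)
    (f : T -> R) (M : R) (e : R) : UltraFilter F -> 0 < e ->
  (forall t, `|f t| <= M) ->
  exists2 A, F A & forall s t, A s -> A t -> `|f s - f t| < e.
Proof.
move=> FU e0 fM; have := @segment_compact R (- M) M.
rewrite compact_ultra => /(_ (f @ F) (ultra_fmap f FU)) [].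
  change (F (f @^-1` `[- M, M])); apply: filterS filterT => t _ /=.
  by rewrite in_itv /= -ler_norml.
move=> l [_ fl]; exists [set t | `|l - f t| < e / 2].
  have e2 : 0 < e / 2 by rewrite divr_gt0.
  have {}fl : f t @[t --> F] --> l by exact: fl.
  by move/cvgrPdist_lt : fl => /(_ _ e2).
move=> s t /= ls lt; rewrite -(subrKA l); apply: le_lt_trans (ler_normD _ _) _.
by rewrite [X in X + _]distrC; lra.
Qed.

(** * Compactness and diagonalization *)

Section compactness.
Context (R : realType) (H : completeNormedModType R[i]).
Context (dot : {dot H for Num.conj}) (dotH : induces_norm dot).
Context (infH : infinite_dimensional H).
Context (G : operator H) (posG : positive dot G) (saG : selfadjoint dot G).
Context (infG : inf [set rnorm (G phi) | phi in
                   [set phi | op_dom G phi /\ rnorm phi = 1]] = 0).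
Context (E : R) (E_gt0 : 0 < E).
Local Notation ip := (re_dot dot).
Local Notation S := (sqrt_operator dot G).
Local Notation "`| A |_E" := (Enorm dot G E A).
Context (small : forall (e : R), 0 < e ->
  exists (s : seq H) (d : R), 0 < d /\ forall D, BH D -> opnorm D <= 1 ->
    (forall x, x \in s -> rnorm (D x) < d) -> `|D|_E < e).

(* The smallness hypothesis is applied to rank-one operators only. *)
Lemma weakly_small (K e : R) : 0 < e -> exists (s : seq H) (d : R), 0 < d /\
  forall y, rnorm y <= 1 -> (forall x, x \in s -> `|ip x y| < d) ->
  forall x, op_dom S x -> rnorm x <= 1 -> rnorm (S x) <= K -> `|ip y x| < e.
Proof.
move=> e0; have [u u1] := exists_unit infH.
have [c c0 cP] := Enorm_controls dotH infH posG saG infG E_gt0 K.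
have [s [d [d0 sd]]] := small (divr_gt0 e0 c0).
(* The hypothesis on [y] concerns real parts only; adding the multiples by ['i] controls imaginary
   parts, whence also [d / 2]. *)
exists (s ++ [seq 'i *: x | x <- s]), (d / 2); split; first by rewrite divr_gt0.
move=> y y1 sy x Sx x1 xK.
have hD := rank_oneP dotH u y.
have DE z : rnorm (rank_one dot u y z) = rnorm (dot z y).
  by rewrite /rank_one rnormZ u1 mulr1.
have D1 : opnorm (rank_one dot u y) <= 1.
  apply: opnorm_le => // z z1; rewrite DE; apply: le_trans (dot_le dotH _ _) _.
  by rewrite z1 mul1r.
have Dd : `|rank_one dot u y|_E < e / c.
  apply: sd => // z zs; rewrite DE; apply: le_lt_trans (dot_le_ip _ _ _) _.
  have h1 := sy z; have h2 := sy ('i *: z).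
  rewrite !mem_cat zs map_f ?orbT // in h1 h2.
  by have := h1 isT; have := h2 isT; lra.
rewrite ipC; apply: le_lt_trans (Re_le_rnorm _) _; rewrite -DE.
by apply: le_lt_trans (cP _ _ hD Sx x1 xK) _; rewrite mulrC -ltr_pdivlMr.
Qed.

(** Along an ultrafilter the pairings with finitely many test vectors become close, so [y], half of
    [x n - x m], is weakly small. Pairing [y] with [x n] and [x m], both of bounded energy, then
    makes [x n - x m] small in norm. *)
Lemma bounded_energy_cvg (K : R) (F : set_system nat) (x : nat -> H) :
  UltraFilter F ->
  (forall n, [/\ op_dom S (x n), rnorm (x n) <= 1 & rnorm (S (x n)) <= K]) ->
  exists l : H, x @ F --> l.
Proof.
move=> FU xP; have [|l xl] := @complete_rnorm R H nat F _ x; last first.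
  by exists l; apply/cvg_rnormP.
move=> e e0; have e8 : 0 < e ^+ 2 / 8 by rewrite divr_gt0 ?exprn_gt0.
have [s [d [d0 sd]]] := weakly_small K e8.
have [A FA Ad] : exists2 A, F A & forall n m, A n -> A m ->
    forall z, z \in s -> `|ip z (x n) - ip z (x m)| < d.
  elim: s {sd} => [|z s [A FA ih]].
    by exists setT => //; exact: filterT.
  have [|B FB Bd] := @ultra_bounded_close R nat F (fun n => ip z (x n)) (rnorm z) d FU d0.
    move=> n; apply: le_trans (ip_le dotH _ _) _.
    by rewrite ler_piMr ?rnorm_ge0 //; have [] := xP n.
  exists (A `&` B); first exact: filterI.
  move=> n m [An Bn] [Am Bm] w; rewrite inE => /predU1P[->|]; first exact: Bd.
  exact: ih.
exists A => // n m An Am.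
have [Sn xn1 xnK] := xP n; have [Sm xm1 xmK] := xP m.
set y := half (x n - x m).
have y1 : rnorm y <= 1.
  by rewrite rnorm_half ler_pdivrMr // mul1r; apply: le_trans (rnormB _ _) _; lra.
have yd z : z \in s -> `|ip z y| < d.
  move=> zs; rewrite ipZr ipBr normrM ger0_norm ?invr_ge0 //.
  have := Ad n m An Am z zs; have := normr_ge0 (ip z (x n) - ip z (x m)); lra.
have yn := sd y y1 yd _ Sn xn1 xnK; have ym := sd y y1 yd _ Sm xm1 xmK.
rewrite -(@ltr_pXn2r _ 2) ?nnegrE ?rnorm_ge0 ?(ltW e0) //.
have -> : rnorm (x n - x m) ^+ 2 = 2 * (ip y (x n) - ip y (x m)).
  by rewrite -ipBr ipZl (ipxx dotH); field.
move: yn ym; rewrite !ltr_norml => /andP[? ?] /andP[? ?].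
by lra.
Qed.

End compactness.

(** * Eigenvectors as energy minimizers on orthogonal complements *)

Section variational.
Context (R : realType) (H : completeNormedModType R[i]).
Context (dot : {dot H for Num.conj}) (dotH : induces_norm dot).
Context (infH : infinite_dimensional H).
Context (G : operator H) (posG : positive dot G) (saG : selfadjoint dot G).
Local Notation ip := (re_dot dot).
Local Notation S := (sqrt_operator dot G).
Implicit Types (ts : seq H) (x y t : H).

Context (energy_cvg : forall (K : R) (F : set_system nat) (x : nat -> H),
  UltraFilter F ->
  (forall n, [/\ op_dom S (x n), rnorm (x n) <= 1 & rnorm (S (x n)) <= K]) ->
  exists l : H, x @ F --> l).

Definition perp ts x := forall t, t \in ts -> dot x t = 0.

Definition spanned ts x := exists c : nat -> R[i], x = \sum_(i < size ts) c i *: ts`_i.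

(* t is a minimizer of the energy on the unit sphere of the complement of ts,
   hence the next eigenvector, with eigenvalue |S t|^2. *)
Definition next_eigenvector ts t :=
  [/\ op_dom G t, G t = (rnorm (S t) ^+ 2)%:C *: t, rnorm t = 1, perp ts t &
      forall y, op_dom S y -> perp ts y ->
        rnorm (S t) ^+ 2 * rnorm y ^+ 2 <= rnorm (S y) ^+ 2].

(** Here [p] is the orthogonal projection of [x] on the span, and [G p] stays in the span; vectors
    can thus be tested separately on the span and on its complement. *)
Definition reducing ts := forall x, exists p,
  [/\ spanned ts p, op_dom G p, spanned ts (G p) & perp ts (x - p)].

Lemma spanned0 ts : spanned ts 0.
Proof. by exists (fun=> 0); rewrite big1 // => i _; rewrite scale0r. Qed.

Lemma spanned_cons t ts a x : spanned ts x -> spanned (t :: ts) (a *: t + x).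
Proof.
move=> [c ->]; exists (fun i => if i is j.+1 then c j else a).
by rewrite big_ord_recl.
Qed.

Lemma perp_spanned ts x p : perp ts x -> spanned ts p -> dot x p = 0.
Proof.
move=> xts [c ->]; rewrite dot_sumr big1 // => i _.
by rewrite dotZr xts ?mulr0 // mem_nth.
Qed.

Lemma reducing_nil : reducing [::].
Proof.
move=> x; exists 0; rewrite op0; split=> //; [exact: spanned0|exact: op_dom0|].
exact: spanned0.
Qed.

Lemma reducing_cons ts t : reducing ts -> next_eigenvector ts t ->
  reducing (t :: ts).
Proof.
move=> red [Gt Et t1 tts _] x; have [p [sp Gp sGp xp]] := red x.
set a := dot (x - p) t.
exists (a *: t + p); split.
- exact: spanned_cons.
- exact: op_domP.
- by rewrite op_linear // Et scalerA; exact: spanned_cons.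
- have -> : x - (a *: t + p) = (x - p) - a *: t by rewrite opprD addrCA addrC.
  move=> s; rewrite inE dotBl dotZl => /predU1P[->|sts].
    by rewrite (dotxx dotH) t1 expr1n mulr1 subrr.
  by rewrite xp // tts // mulr0 subr0.
Qed.

Lemma perpD ts x y : perp ts x -> perp ts y -> perp ts (x + y).
Proof. by move=> xp yp t tt; rewrite dotDl xp // yp // addr0. Qed.

Lemma perpZ ts a x : perp ts x -> perp ts (a *: x).
Proof. by move=> xp t tt; rewrite dotZl xp // mulr0. Qed.

Lemma domGS x : op_dom G x -> op_dom S x.
Proof. by move=> /(domG_sqrt dotH posG saG)[]. Qed.

(** The nonzero vector [x - p] of the complement may lie outside the domain of [S]. A domain vector
    [y0] closer to it than its norm cannot lie in the span, so removing its projection [q] leaves a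
    nonzero vector. *)
Lemma exists_perp_unit ts : reducing ts ->
  exists y, [/\ op_dom S y, rnorm y = 1 & perp ts y].
Proof.
move=> red; have [x xts] := infH (fun i : 'I_(size ts) => ts`_i).
have [p [[c pE] Gp _ xp]] := red x.
have xp0 : 0 < rnorm (x - p).
  rewrite rnorm_gt0 subr_eq0; apply/negP => /eqP xE.
  by have := xts (fun i => c i); rewrite xE pE eqxx.
have [y0 Sy0 xy] := dense_rnormP (sqrt_sa dotH posG saG).1 (x - p) xp0.
have [q [sq Gq _ yq]] := red y0.
have y0q : y0 - q != 0.
  apply/negP => /eqP/eqP; rewrite subr_eq0 => /eqP yE.
  have : rnorm (x - p - y0) ^+ 2 < rnorm (x - p) ^+ 2.
    by rewrite ltr_pXn2r ?nnegrE ?rnorm_ge0.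
  rewrite (rnorm_sqrB dotH) /re_dot yE (perp_spanned xp sq) mulr0 subr0.
  by have := sqr_ge0 (rnorm q); lra.
exists ((rnorm (y0 - q))^-1%:C *: (y0 - q)); split.
- by apply/op_domZ/op_domB => //; exact: domGS.
- exact: normalized.
- exact: perpZ.
Qed.

(** A minimizing sequence converges along an ultrafilter by [energy_cvg]; its images under [S]
    converge too, and closedness of [S] makes the limit a minimizer. *)
Lemma next_eigenvector_exists ts : reducing ts -> exists t, next_eigenvector ts t.
Proof.
move=> red; have saS := sqrt_sa dotH posG saG.
pose A := [set rnorm (S y) ^+ 2 | y in
  [set y | [/\ op_dom S y, rnorm y = 1 & perp ts y]]].
have A0 : A !=set0.
  by have [y yP] := exists_perp_unit red; exists (rnorm (S y) ^+ 2), y.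
have Alb : lbound A 0 by move=> _ [y _ <-]; exact: sqr_ge0.
have Ainf : has_inf A by split=> //; exists 0.
set m := inf A.
have m0 : 0 <= m by apply: lb_le_inf.
have mA y : op_dom S y -> perp ts y -> m * rnorm y ^+ 2 <= rnorm (S y) ^+ 2.
  move=> Sy yp; have [->|y0] := eqVneq y 0.
    by rewrite rnorm0 expr0n mulr0 sqr_ge0.
  have n0 : 0 < rnorm y by rewrite rnorm_gt0.
  rewrite -ler_pdivlMr ?exprn_gt0 //; apply: ge_inf; first by exists 0.
  exists ((rnorm y)^-1%:C *: y).
    by split; [exact: op_domZ|exact: normalized|exact: perpZ].
  by rewrite opZ // rnormZr gtr0_norm ?invr_gt0 // exprMn exprVn mulrC.
have /choice[x xP] : forall n, exists x, [/\ op_dom S x, rnorm x = 1, perp ts x &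
    rnorm (S x) ^+ 2 < m + n.+1%:R^-1].
  move=> n; have n0 : 0 < n.+1%:R^-1 :> R by rewrite invr_gt0 ltr0n.
  by have [_ [x [Sx x1 xp] <-] xm] := inf_adherent n0 Ainf; exists x.
have xK n : rnorm (S (x n)) <= m + 1.
  have [_ _ _ xm] := xP n.
  rewrite -(@ler_pXn2r _ 2) ?nnegrE ?rnorm_ge0 ?addr_ge0 //.
  apply: le_trans (ltW xm) _; rewrite sqrrD mulr1 expr1n.
  have : n.+1%:R^-1 <= 1 :> R by rewrite invf_le1 ?ltr0n // ler1n.
  by have := sqr_ge0 m; set k := n.+1%:R^-1; lra.
have [F [FU sF]] := ultraFilterLemma (@eventually_filter).
have [l xl] : exists l : H, x @ F --> l.
  by apply: (energy_cvg (K := m + 1)) => n; have [? -> _ _] := xP n.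
have /cvg_rnormP xl' := xl.
have [z Sxz] : exists z : H, forall e, 0 < e -> \forall n \near F, rnorm (S (x n) - z) < e.
  apply: complete_rnorm => e e0.
  have e8 : 0 < e ^+ 2 / 8 by rewrite divr_gt0 ?exprn_gt0.
  (* By the parallelogram identity, the squared norm of [S (x n) - S (x k)] is at most the excesses
     over [m], below [e ^+ 2 / 2] in total, plus [m * rnorm (x n - x k) ^+ 2], which this [d] keeps
     below [e ^+ 2 / 4]; [m + 1] avoids dividing by 0. *)
  pose d := Num.min 1 (e ^+ 2 / 16 / (m + 1)).
  have m1 : 0 < m + 1 by rewrite ltr_wpDl.
  have d0 : 0 < d by rewrite lt_min ltr01 !divr_gt0 ?exprn_gt0.
  exists [set n | n.+1%:R^-1 < e ^+ 2 / 8 /\ rnorm (x n - l) < d].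
    by apply: filterI; [exact/sF/invS_lt|exact: xl'].
  move=> n k [/= ne nl] [ke kl].
  have [Sn n1 np nm] := xP n; have [Sk k1 kp km] := xP k.
  have h1 := mA _ (op_domD Sn Sk) (perpD np kp).
  have h2 := parallelogram dotH (x n) (x k).
  have h3 := parallelogram dotH (S (x n)) (S (x k)).
  rewrite opD // in h1; rewrite n1 k1 in h2.
  have h4 : rnorm (x n - x k) < 2 * d.
    rewrite -(subrKA l); apply: le_lt_trans (rnormD _ _) _.
    by rewrite [X in _ + X]rnormBC; lra.
  have d1 : d <= 1 by rewrite ge_min lexx.
  have dm : (m + 1) * d <= e ^+ 2 / 16.
    by rewrite mulrC -ler_pdivlMr // ge_min lexx orbT.
  have h5 : m * rnorm (x n - x k) ^+ 2 <= e ^+ 2 / 4.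
    have h6 : rnorm (x n - x k) ^+ 2 <= 4 * d.
      have := rnorm_ge0 (x n - x k); nra.
    have := sqr_ge0 (rnorm (x n - x k)); nra.
  rewrite -(@ltr_pXn2r _ 2) ?nnegrE ?rnorm_ge0 ?(ltW e0) //.
  have e20 : 0 < e ^+ 2 by rewrite exprn_gt0.
  move: ne ke nm km; set a := n.+1%:R^-1; set b := k.+1%:R^-1 => *.
  have h7 : m * (rnorm (x n + x k) ^+ 2 + rnorm (x n - x k) ^+ 2) = m * 4.
    by rewrite h2 expr1n; ring.
  by rewrite mulrDr in h7; lra.
have [Sl Slz] : op_dom S l /\ S l = z.
  apply: (selfadjoint_closed dotH saS) => e e0.
  have [n [/= nl nz]] := filter_ex (filterI (xl' _ e0) (Sxz _ e0)).
  by exists (x n); split => //; have [] := xP n.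
have l1 : rnorm l = 1.
  apply: (cvg_uniq (cvg_rnorm xl)); rewrite (_ : (fun n => _) = fun=> 1).
    exact: cvg_cst.
  by apply/funext => n; have [] := xP n.
have lp : perp ts l.
  move=> t tts; apply/eqP; rewrite -rnorm_eq0; apply/eqP/le_anti.
  rewrite rnorm_ge0 andbT; apply/ler_addgt0Pr => e e0; rewrite add0r.
  have t0 : 0 < rnorm t + 1 by rewrite ltr_wpDl ?rnorm_ge0.
  have [n /=] := filter_ex (xl' _ (divr_gt0 e0 t0)); rewrite ltr_pdivlMr // => nl.
  have [_ _ np _] := xP n.
  have -> : dot l t = dot (l - x n) t by rewrite dotBl np // subr0.
  apply: le_trans (dot_le dotH _ _) _; rewrite rnormBC.
  by have := rnorm_ge0 (x n - l); lra.
have lm : rnorm (S l) ^+ 2 = m.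
  apply/le_anti/andP; split; last first.
    by have := mA _ Sl lp; rewrite l1 expr1n mulr1.
  apply/ler_addgt0Pr => e e0.
  have Sxl : S (x n) @[n --> F] --> S l by apply/cvg_rnormP; rewrite Slz.
  apply: (@closed_cvg _ _ F _ (fun n => rnorm (S (x n)) ^+ 2) [set t | t <= m + e]).
  - exact: closed_le.
  - have := sF _ (invS_lt e0); apply: filterS => n /= ne.
    by have [_ _ _ nm] := xP n; apply: le_trans (ltW nm) _; rewrite lerD2l ltW.
  - by apply: cvgM; exact: cvg_rnorm.
(* The energy of [l + t y] minus [m] times its squared norm is nonnegative for all real [t] and
   vanishes at 0. *)
have first_variation y : op_dom S y -> perp ts y -> ip (S l) (S y) = m * ip l y.
  move=> Sy yp; apply/eqP; rewrite -subr_eq0; apply/eqP.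
  apply: (@linear_term_eq0 _ _ (rnorm (S y) ^+ 2 - m * rnorm y ^+ 2)) => t.
  have Sty : op_dom S (t%:C *: y) by exact: op_domZ.
  have := mA _ (op_domD Sl Sty) (perpD lp (perpZ t%:C yp)).
  rewrite opD // opZ // !(rnorm_sqrD dotH) !ipZr !rnormZr !exprMn.
  by rewrite !real_normK ?num_real // lm l1 expr1n; lra.
(* Any [y] in the domain splits as [(y - p) + p]; on [p] both sides vanish, because [p] and [G p]
   lie in the span and [l] is orthogonal to it. *)
have [SSl SSlE] : op_dom S (S l) /\ S (S l) = m%:C *: l.
  apply: (adjoint_ip saS) => y Sy; have [p [sp Gp sGp yp]] := red y.
  have Sp := domGS Gp.
  rewrite ipZl -[y](subrK p) opD //; last exact: op_domB.
  rewrite [ip (S l) _]ipDr [ip l _]ipDr first_variation //; last exact: op_domB.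
  have [_ SSp] := (domG_sqrt dotH posG saG p).1 Gp.
  have -> : ip (S l) (S p) = 0.
    rewrite (ip_sym saS) // -(G_sqrt dotH posG saG) //.
    by rewrite /re_dot (perp_spanned lp sGp).
  have -> : ip l p = 0 by rewrite /re_dot (perp_spanned lp sp).
  by rewrite !addr0.
have Gl : op_dom G l by apply/(domG_sqrt dotH posG saG).
exists l; split=> //; first by rewrite lm -SSlE; exact: G_sqrt.
by rewrite lm.
Qed.

End variational.

(** * Diagonalization by successive eigenvectors *)

Section diagonalization.
Context (R : realType) (H : completeNormedModType R[i]).
Context (dot : {dot H for Num.conj}) (dotH : induces_norm dot).
Context (infH : infinite_dimensional H).
Context (G : operator H) (posG : positive dot G) (saG : selfadjoint dot G).
Local Notation ip := (re_dot dot).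
Local Notation S := (sqrt_operator dot G).

Context (energy_cvg : forall (K : R) (F : set_system nat) (x : nat -> H),
  UltraFilter F ->
  (forall n, [/\ op_dom S (x n), rnorm (x n) <= 1 & rnorm (S (x n)) <= K]) ->
  exists l : H, x @ F --> l).

Lemma eigenvector_sequence : exists tau : nat -> H,
  forall n, exists2 ts, (forall x, x \in ts <-> exists2 k, (k < n)%N & x = tau k) &
    next_eigenvector dot G ts (tau n).
Proof.
have /choice[step stepP] : forall ts, exists t,
    reducing dot G ts -> next_eigenvector dot G ts t.
  (* The default 0 makes [step] total; the lists built below are all reducing. *)
  move=> ts; have [red|nred] := pselect (reducing dot G ts); last by exists 0.
  by have [t tP] := next_eigenvector_exists dotH infH posG saG energy_cvg red; exists t.
pose eigs := fix eigs n := if n is m.+1 then step (eigs m) :: eigs m else [::].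
have red n : reducing dot G (eigs n).
  elim: n => [|n ih] /=; first exact: reducing_nil.
  by apply: reducing_cons => //; exact: stepP.
exists (fun n => step (eigs n)) => n; exists (eigs n); last exact: stepP.
elim: n => [|n ih] x /=; first by split=> // -[].
rewrite inE; split=> [/predU1P[->|/ih[k kn ->]]|[k]]; first by exists n.
  by exists k => //; exact: ltnW.
rewrite ltnS leq_eqVlt => /predU1P[->->|kn ->]; first by rewrite eqxx.
by rewrite (_ : _ \in eigs n) ?orbT //; apply/ih; exists k.
Qed.

Lemma discrete_of_energy_cvg : discrete_operator dot G.
Proof.
have saS := sqrt_sa dotH posG saG.
have [tau tauN] := eigenvector_sequence.
pose e n := rnorm (S (tau n)) ^+ 2.
have eig n : op_dom G (tau n) /\ G (tau n) = (e n)%:C *: tau n.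
  by have [ts _ []] := tauN n.
have tau1 n : rnorm (tau n) = 1 by have [ts _ []] := tauN n.
have tauD n : op_dom S (tau n) by apply: (domGS dotH posG saG); have [] := eig n.
have orth m n : (m < n)%N -> dot (tau n) (tau m) = 0.
  by move=> mn; have [ts tsP [_ _ _ + _]] := tauN n; apply; apply/tsP; exists m.
have tauP i j : dot (tau i) (tau j) = (i == j)%:R.
  have [ij|ij|->] := ltngtP i j; last by rewrite (dotxx dotH) tau1 expr1n.
  - by rewrite (dotC _ (tau i)) orth // rmorph0.
  - by rewrite orth.
have emin n y : op_dom S y -> (forall k, (k < n)%N -> dot y (tau k) = 0) ->
    e n * rnorm y ^+ 2 <= rnorm (S y) ^+ 2.
  move=> Sy yp; have [ts tsP [_ _ _ _]] := tauN n; apply=> // t /tsP[k kn ->].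
  exact: yp.
have e0 n : 0 <= e n by exact: sqr_ge0.
have emono m n : (m <= n)%N -> e m <= e n.
  move=> mn; have := emin m (tau n) (tauD n); rewrite tau1 expr1n mulr1; apply.
  by move=> k km; apply/orth/(leq_trans km).
(* Were the eigenvalues bounded, [tau] would have bounded energy and converge along an ultrafilter,
   while distinct orthonormal vectors are at squared distance 2. *)
have einfty : e @ \oo --> +oo.
  apply/cvgryPge => A.
  suff [N NA] : exists N, A <= e N.
    by exists N => // n /= Nn; exact: le_trans (emono _ _ Nn).
  apply: contrapT => nA.
  have eA n : e n < A by rewrite ltNge; apply/negP => ?; apply: nA; exists n.
  have [F [FU sF]] := ultraFilterLemma (@eventually_filter).
  have [l] : exists l : H, tau @ F --> l.
    apply: (energy_cvg (K := A + 1)) => n; split; rewrite ?tau1 //.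
    have A0 : 0 <= A by apply: le_trans (e0 0%N) (ltW (eA _)).
    rewrite -(@ler_pXn2r _ 2) ?nnegrE ?rnorm_ge0 ?addr_ge0 //.
    apply: le_trans (ltW (eA n)) _; rewrite sqrrD mulr1 expr1n.
    by have := sqr_ge0 A; lra.
  have h2 : 0 < 1 / 2 :> R by rewrite divr_gt0.
  move=> /cvg_rnormP /(_ _ h2) tl.
  have [n /= nl] := filter_ex tl.
  have [m [/= ml nm]] := filter_ex (filterI tl (sF _ (nbhs_infty_gt n))).
  have : rnorm (tau m - tau n) < 1.
    rewrite -(subrKA l); apply: le_lt_trans (rnormD _ _) _.
    by rewrite [X in _ + X]rnormBC; lra.
  rewrite -(@ltr_pXn2r _ 2) ?nnegrE ?rnorm_ge0 // (rnorm_sqrB dotH) !tau1.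
  by rewrite /re_dot orth //=; lra.
pose P := partial_proj dot tau.
have Gc x k : op_dom G (dot x (tau k) *: tau k) by apply: op_domZ; have [] := eig k.
have GP n x : op_dom G (P n x) by apply: op_dom_sum.
have GPE n x : G (P n x) = \sum_(0 <= k < n) ((e k)%:C * dot x (tau k)) *: tau k.
  rewrite op_sum //; apply: eq_bigr => k _; have [Gk Ek] := eig k.
  by rewrite opZ // Ek !scalerA mulrC.
have PB n x y : P n (x - y) = P n x - P n y.
  by rewrite /P /partial_proj -sumrB; apply: eq_bigr => k _; rewrite dotBl scalerBl.
(* The images under [S] of the remainder and of [P n x] are orthogonal, because [G (P n x)] lies in
   the span of the first [n] eigenvectors. *)
have SP n x : op_dom S x -> rnorm (S (x - P n x)) <= rnorm (S x).
  move=> Sx; have [SPx _] := (domG_sqrt dotH posG saG _).1 (GP n x).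
  rewrite -(@ler_pXn2r _ 2) ?nnegrE ?rnorm_ge0 //.
  have Sd : op_dom S (x - P n x) by exact: op_domB.
  have -> : S x = S (x - P n x) + S (P n x) by rewrite -opD ?subrK.
  rewrite (rnorm_sqrD dotH) (ip_sym saS) //; last first.
    by have [] := (domG_sqrt dotH posG saG _).1 (GP n x).
  rewrite -(G_sqrt dotH posG saG) // GPE /re_dot dot_sumr big_nat big1.
    by rewrite /= mulr0 addr0 lerDl sqr_ge0.
  by move=> k /= kn; rewrite dotZr (partial_proj_perp tauP) ?mulr0.
(* For [y] in the domain of [S], minimality of [e n] bounds the remainder by
   [rnorm (S y) ^+ 2 / e n], in squared norm. Density extends this to all [x], since [1 - P n] is a
   contraction. *)
have complete x : P n x @[n --> \oo] --> x.
  apply/cvg_rnormP => d d0; have d2 : 0 < d / 2 by rewrite divr_gt0.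
  have [y Sy xy] := dense_rnormP saS.1 x d2.
  have d4 : 0 < (d / 2) ^+ 2 by rewrite exprn_gt0.
  have /cvgryPgt/(_ (rnorm (S y) ^+ 2 / (d / 2) ^+ 2)) := einfty.
  apply: filterS => n; rewrite ltr_pdivrMr // => en.
  have yn : rnorm (y - P n y) < d / 2.
    rewrite -(@ltr_pXn2r _ 2) ?nnegrE ?rnorm_ge0 ?(ltW d2) //.
    have en0 : 0 < e n.
      rewrite lt_def e0 andbT; apply: contraTneq en => ->.
      by rewrite mul0r -leNgt sqr_ge0.
    rewrite -(ltr_pM2l en0); apply: le_lt_trans en.
    apply: le_trans (emin n _ _ _) _.
    - by apply: op_domB => //; apply: (domGS dotH posG saG).
    - by move=> k kn; exact: (partial_proj_perp tauP).
    - by rewrite ler_pXn2r ?nnegrE ?rnorm_ge0 ?SP.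
  rewrite rnormBC; have -> : x - P n x = (x - y - P n (x - y)) + (y - P n y).
    by rewrite PB [RHS]addrACA subrK -opprD subrK.
  apply: le_lt_trans (rnormD _ _) _.
  by have := partial_proj_compl_le dotH tauP n (x - y); rewrite -/(P n _); lra.
have dotZR (a : R) x y : dot x (a%:C *: y) = a%:C * dot x y.
  by rewrite dotZr; congr (_ * _); exact: conjc_real.
have eM k x : e k ^+ 2 * rnorm (dot x (tau k)) ^+ 2 =
    rnorm ((e k)%:C * dot x (tau k)) ^+ 2.
  rewrite -exprMn; congr (_ ^+ 2); apply: complexI.
  by rewrite -rnormE normrM !rnormE rnormC ger0_norm // rmorphM.
exists tau, e; split; [split=> //; split=> //|split].
- by move=> i j; rewrite /braket tauP eq_sym.
- apply/seteqP; split=> x /=.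
    (* By symmetry the coefficients of [G x] are those of [x] times [e k], so Bessel's inequality
       bounds the partial sums. *)
    move=> Gx; apply/nneseries_ltyP; first by move=> n; rewrite mulr_ge0 ?sqr_ge0.
    exists (rnorm (G x) ^+ 2) => n; apply: le_trans (bessel dotH tauP n (G x)).
    apply: ler_sum => k _; have [Gk Ek] := eig k.
    by rewrite (dot_sym saG) // Ek dotZR /braket eM.
  move=> /nneseries_ltyP[|M xM]; first by move=> n; rewrite mulr_ge0 ?sqr_ge0.
  (* [u n] is [G (P n x)], Cauchy because its squared increments are those of the bounded
     nondecreasing sequence [s]; closedness of [G] then puts [x] in the domain. *)
  pose u n := \sum_(0 <= k < n) ((e k)%:C * dot x (tau k)) *: tau k.
  pose s n := \sum_(0 <= k < n) e k ^+ 2 * rnorm (dot x (tau k)) ^+ 2.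
  have [z ze] : exists z, forall d, 0 < d -> \forall n \near \oo, rnorm (u n - z) < d.
    have [|r sr sle] := @nondecreasing_bounded_cvg R s M _ xM.
      by move=> n; rewrite /s big_nat_recr //= lerDl mulr_ge0 ?sqr_ge0.
    apply: complete_rnorm => d d0.
    have d2 : 0 < d ^+ 2 by rewrite exprn_gt0.
    exists [set n | `|r - s n| < d ^+ 2]; first by move/cvgrPdist_lt : sr; apply.
    have key n m : (n <= m)%N -> `|r - s n| < d ^+ 2 -> rnorm (u m - u n) < d.
      move=> nm rn; rewrite -(@ltr_pXn2r _ 2) ?nnegrE ?rnorm_ge0 ?(ltW d0) //.
      have -> : u m - u n = \sum_(n <= k < m) ((e k)%:C * dot x (tau k)) *: tau k.
        apply/eqP; rewrite subr_eq [eqbRHS]addrC; apply/eqP.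
        exact: (big_cat_nat (leq0n n) nm).
      rewrite (rnorm_orthonormal_sum dotH tauP) ?iota_uniq //.
      have -> : \sum_(n <= k < m) rnorm ((e k)%:C * dot x (tau k)) ^+ 2 = s m - s n.
        apply/eqP; rewrite eq_sym subr_eq [eqbRHS]addrC; apply/eqP.
        rewrite [LHS](big_cat_nat (leq0n n) nm); congr (_ + _).
        by apply: eq_bigr => k _; exact: eM.
      apply: le_lt_trans rn; apply: le_trans (ler_norm _).
      by rewrite lerB.
    move=> n m /= nr mr; have [nm|/ltnW mn] := leqP n m; last exact: key.
    by rewrite rnormBC; exact: key.
  have [] // : op_dom G x /\ G x = z.
  apply: (selfadjoint_closed dotH saG) => d d0.
  have /cvg_rnormP xP := complete x.
  have [n [/= nx nz]] := filter_ex (filterI (xP _ d0) (ze _ d0)).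
  by exists (P n x); rewrite GPE.
- move=> x Gx; have := complete (G x).
  rewrite (_ : (fun n => P n (G x)) =
    series (fun k => ((e k)%:C * dot x (tau k)) *: tau k)) //.
  apply/funext => n; apply: eq_bigr => k _; have [Gk Ek] := eig k.
  by rewrite (dot_sym saG) // Ek dotZR.
Qed.

End diagonalization.

Theorem proposition2 (R : realType) (H : completeNormedModType R[i])
    (dot : {dot H for Num.conj}) (dotH : induces_norm dot)
    (sepH : separable H) (infH : infinite_dimensional H)
    (G : operator H) (posG : positive dot G) (saG : selfadjoint dot G)
    (infG : inf [set rnorm (G phi) | phi in
                   [set phi | op_dom G phi /\ rnorm phi = 1]] = 0)
    (E : R) (E_gt0 : 0 < E) :
  (equivalent_norms (Enorm dot G E) (@opnorm R H) <-> bounded_operator G) /\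
  (generates_sot_on_bounded (Enorm dot G E) <->
     ~ bounded_operator G /\ discrete_operator dot G).
Proof.
split; split.
- exact: bounded_of_equivalent.
- exact: equivalent_of_bounded.
- move=> gen; have discG : discrete_operator dot G.
    apply: discrete_of_energy_cvg => // K F x FU xP.
    apply: (bounded_energy_cvg dotH infH posG saG infG E_gt0 _ FU xP).
    exact: small_of_generates_sot.
  (* A bound [M] for [G] fails at the unit eigenvector [tau n] as soon as [e n] exceeds [M]. *)
  split=> // -[M GM]; have [tau [e [[tauB _ _ einfty] [domG GE]]]] := discG.
  have tauP i j : dot (tau i) (tau j) = (i == j)%:R by rewrite eq_sym; exact: tauB.1.
  have eig := discrete_eigenvectors tauP domG GE.
  have /cvgryPgt/(_ M)[n _ /(_ n (leqnn n))] := einfty.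
  have [Gn En] := eig n; have := GM _ Gn.
  rewrite En rnormZr (rnorm_tau dotH tauP) !mulr1 => /(le_trans (ler_norm _)).
  by rewrite leNgt => /negbTE ->.
- move=> [_ discG]; apply: generates_sot_of_small => //.
  exact: small_of_discrete.
Qed.
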